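(* Let $k>4$ be an integer. In $\mathbb{R}^3$ with coordinates $(x,y,t)$, define the semialgebraic surfaces $$X_1=\Big\{\big((x^2-2xt+y^2)(x^2+2xt+y^2)-t^k\big)\Big((x-t)^2+\big(y-\tfrac{t}{2}\big)^2-\tfrac{t^2}{16}\Big)\Big((x-t)^2+\big(y+\tfrac{t}{2}\big)^2-\tfrac{t^2}{16}\Big)=0,\ t\ge 0\Big\},$$ $$X_2=\Big\{\big((x^2-2xt+y^2)(x^2+2xt+y^2)-t^k\big)\Big((x-t)^2+y^2-\tfrac{t^2}{16}\Big)\Big((x+t)^2+y^2-\tfrac{t^2}{16}\Big)=0,\ t\ge 0\Big\}.$$ Then the germs at the origin of $X_1$ and $X_2$ are bi-Lipschitz equivalent with respect to the outer metric and ambient topologically equivalent, but they are not ambient Lipschitz equivalent.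
   Context: For germs at $0$ of semialgebraic sets $X,Y\subset\mathbb{R}^n$: the outer metric on $X$ is the restriction of the Euclidean distance of $\mathbb{R}^n$; $X$ and $Y$ are bi-Lipschitz equivalent with respect to the outer metric if there is a germ of homeomorphism $X\to Y$ that is bi-Lipschitz for the outer metrics. They are ambient topologically equivalent if there is a germ of homeomorphism $(\mathbb{R}^n,0)\to(\mathbb{R}^n,0)$ mapping the germ of $X$ onto the germ of $Y$, and ambient Lipschitz (bi-Lipschitz) equivalent if there is such a germ of homeomorphism that is bi-Lipschitz. *)

(* Defs.v *)
From Stdlib Require Import Reals Lra.
Open Scope R_scope.

Definition pt : Type := (R * R * R)%type.
Definition origin : pt := (0, 0, 0).

(* Euclidean distance on R^3 (the outer metric is its restriction). *)
Definition dist (p q : pt) : R :=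
  match p, q with
  | (x1, y1, t1), (x2, y2, t2) =>
      sqrt ((x1 - x2) ^ 2 + (y1 - y2) ^ 2 + (t1 - t2) ^ 2)
  end.

Definition is_open (U : pt -> Prop) : Prop :=
  forall p, U p -> exists e, 0 < e /\ forall q, dist p q < e -> U q.

Definition continuous_on (A : pt -> Prop) (f : pt -> pt) : Prop :=
  forall p, A p -> forall e, 0 < e ->
    exists d, 0 < d /\ forall q, A q -> dist p q < d -> dist (f p) (f q) < e.

Definition bilipschitz_on (A : pt -> Prop) (f : pt -> pt) (L : R) : Prop :=
  0 < L /\ forall p q, A p -> A q ->
    dist (f p) (f q) <= L * dist p q /\ dist p q <= L * dist (f p) (f q).

Definition bilip_outer_equiv (X Y : pt -> Prop) : Prop :=
  exists (U V : pt -> Prop) (h g : pt -> pt) (L : R),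
    is_open U /\ is_open V /\ U origin /\ V origin /\
    h origin = origin /\
    (forall p, X p -> U p -> Y (h p) /\ V (h p)) /\
    (forall q, Y q -> V q -> X (g q) /\ U (g q)) /\
    (forall p, X p -> U p -> g (h p) = p) /\
    (forall q, Y q -> V q -> h (g q) = q) /\
    bilipschitz_on (fun p => X p /\ U p) h L.

Definition ambient_homeo_germ (X Y : pt -> Prop) (U V : pt -> Prop)
    (H G : pt -> pt) : Prop :=
  is_open U /\ is_open V /\ U origin /\ V origin /\
  H origin = origin /\
  (forall p, U p -> V (H p)) /\
  (forall q, V q -> U (G q)) /\
  (forall p, U p -> G (H p) = p) /\
  (forall q, V q -> H (G q) = q) /\
  continuous_on U H /\ continuous_on V G /\
  (exists r, 0 < r /\ forall q, dist q origin < r ->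
      (Y q <-> exists p, U p /\ X p /\ H p = q)).

Definition ambient_topo_equiv (X Y : pt -> Prop) : Prop :=
  exists U V H G, ambient_homeo_germ X Y U V H G.

Definition ambient_lip_equiv (X Y : pt -> Prop) : Prop :=
  exists U V H G L, ambient_homeo_germ X Y U V H G /\ bilipschitz_on U H L.

Definition quartic (k : nat) (x y t : R) : R :=
  (x ^ 2 - 2 * x * t + y ^ 2) * (x ^ 2 + 2 * x * t + y ^ 2) - t ^ k.

Definition X1 (k : nat) (p : pt) : Prop :=
  match p with
  | (x, y, t) =>
      quartic k x y t
      * ((x - t) ^ 2 + (y - t / 2) ^ 2 - t ^ 2 / 16)
      * ((x - t) ^ 2 + (y + t / 2) ^ 2 - t ^ 2 / 16) = 0 /\ 0 <= t
  end.

Definition X2 (k : nat) (p : pt) : Prop :=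
  match p with
  | (x, y, t) =>
      quartic k x y t
      * ((x - t) ^ 2 + y ^ 2 - t ^ 2 / 16)
      * ((x + t) ^ 2 + y ^ 2 - t ^ 2 / 16) = 0 /\ 0 <= t
  end.

(* Main.v *)
(* The sections of both surfaces consist of a loop pinched at a neck of width of order
   t^(k/4), which is much smaller than t, and of two tubes (circular cones) inside it; the
   tubes lie in one lobe for X1 and in different lobes for X2.

   Outer equivalence: the three pieces have mutual distances comparable with t, so it is
   enough to keep the loop fixed and to shift each tube linearly.

   Ambient topological equivalence: stretch each section vertically so that the neck gets
   width comparable with t, carry one tube to the other lobe by a conical homeomorphism
   supported inside the loop, and undo the stretch.

   No ambient bi-Lipschitz equivalence: since the two sides of the neck are close but are
   not joined by short paths, the loop of X2 corresponds to the loop of X1, hence tubes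
   correspond to tubes.  The segment joining the tubes of X1 stays at distance at least
   c t from the loop, but its image joins the two lobes inside the loop of X2, so it
   passes through the neck, at distance o(t) from that loop. *)
From Stdlib Require Import Reals Lra Lia Classical.
Require Import Defs.
Open Scope R_scope.

(** The germ need not preserve [t], so the points of one section may go to different heights and no
    section-by-section argument is available: every estimate is made in three variables with one
    constant [M], and compared with [t] through the conical size of the pieces. Connectedness is
    used only in the form that a continuous function without zeros keeps its sign along a segment.
    Loop sections and tubes are reached from segments by radial projection, and the signs that are
    followed are those of [xc], [yc], [marker] and [side], which tell pieces, tubes or lobes apart.
    The hypothesis [k > 4] enters as [t^(k/4) <= e t] for small [t], with [e] of order [1 / M^2]:
    one factor [M] for the map and one for its inverse. For the topological equivalence the obstacle
    is that a conical map supported inside the loop cannot cross a neck thinner than every cone. The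
    stretch that opens the neck degenerates as [t] tends to 0; continuity of the conjugated map
    there is recovered from the fact that it displaces points by [O(t)]. *)

(** * Coordinates and the sum metric *)

Definition xc (p : pt) : R := fst (fst p).
Definition yc (p : pt) : R := snd (fst p).
Definition tc (p : pt) : R := snd p.

(** Equivalent to [dist] up to the factor 2, a rounding of the square root of 3; it keeps the
    estimates linear in absolute values. *)
Definition d1 (p q : pt) : R :=
  Rabs (xc p - xc q) + Rabs (yc p - yc q) + Rabs (tc p - tc q).

Lemma pt_eta (p : pt) : p = (xc p, yc p, tc p).
Proof. now destruct p as [[x y] t]. Qed.

Lemma dist_le_d1 (p q : pt) : dist p q <= d1 p q.
Proof.
  destruct p as [[x y] t], q as [[x' y'] t']. unfold d1, dist, xc, yc, tc; simpl fst; simpl snd.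
  pose proof (Rabs_pos (x - x')). pose proof (Rabs_pos (y - y')).
  pose proof (Rabs_pos (t - t')).
  rewrite <- (sqrt_Rsqr (Rabs (x - x') + Rabs (y - y') + Rabs (t - t'))) by lra.
  apply sqrt_le_1_alt.
  rewrite <- (pow2_abs (x - x')),
    <- (pow2_abs (y - y')), <- (pow2_abs (t - t')). unfold Rsqr. nra.
Qed.

Lemma d1_le_dist (p q : pt) : d1 p q <= 2 * dist p q.
Proof.
  destruct p as [[x y] t], q as [[x' y'] t']. unfold d1, dist, xc, yc, tc; simpl fst; simpl snd.
  rewrite <- (pow2_abs (x - x')), <- (pow2_abs (y - y')), <- (pow2_abs (t - t')).
  set (a := Rabs (x - x')). set (b := Rabs (y - y')). set (c := Rabs (t - t')).
  assert (Ha : 0 <= a) by apply Rabs_pos. assert (Hb : 0 <= b) by apply Rabs_pos.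
  assert (Hc : 0 <= c) by apply Rabs_pos.
  set (n := a ^ 2 + b ^ 2 + c ^ 2).
  assert (Hn : 0 <= n) by (unfold n; nra).
  pose proof (sqrt_pos n). pose proof (sqrt_sqrt n Hn).
  apply Rsqr_incr_0_var; [|lra]. unfold Rsqr.
  replace (2 * sqrt n * (2 * sqrt n)) with (4 * (sqrt n * sqrt n)) by ring.
  rewrite H0. unfold n.
  pose proof (pow2_ge_0 (a - b)). pose proof (pow2_ge_0 (a - c)).
  pose proof (pow2_ge_0 (b - c)). nra.
Qed.

Lemma d1_sym (p q : pt) : d1 p q = d1 q p.
Proof. unfold d1. now rewrite (Rabs_minus_sym (xc p)), (Rabs_minus_sym (yc p)), (Rabs_minus_sym (tc p)). Qed.

Lemma d1_refl (p : pt) : d1 p p = 0.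
Proof. unfold d1. rewrite !Rminus_diag, Rabs_R0. ring. Qed.

Lemma d1_triangle (p q r : pt) : d1 p r <= d1 p q + d1 q r.
Proof.
  unfold d1.
  assert (T : forall a b c, Rabs (a - c) <= Rabs (a - b) + Rabs (b - c)).
  { intros. replace (a - c) with ((a - b) + (b - c)) by ring. apply Rabs_triang. }
  pose proof (T (xc p) (xc q) (xc r)). pose proof (T (yc p) (yc q) (yc r)).
  pose proof (T (tc p) (tc q) (tc r)). lra.
Qed.

Lemma d1_pos (p q : pt) : 0 <= d1 p q.
Proof.
  unfold d1. pose proof (Rabs_pos (xc p - xc q)). pose proof (Rabs_pos (yc p - yc q)).
  pose proof (Rabs_pos (tc p - tc q)). lra.
Qed.

Lemma d1_coord (p q : pt) :
  Rabs (xc p - xc q) <= d1 p q /\ Rabs (yc p - yc q) <= d1 p q /\ Rabs (tc p - tc q) <= d1 p q.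
Proof.
  unfold d1. pose proof (Rabs_pos (xc p - xc q)). pose proof (Rabs_pos (yc p - yc q)).
  pose proof (Rabs_pos (tc p - tc q)). lra.
Qed.

(** * Continuity of real functions of a point *)

(** Continuity is relative to a set because the stretch is handled only on [t > 0] and a germ is
    controlled only near the origin. *)
Definition rcont (A : pt -> Prop) (f : pt -> R) : Prop :=
  forall p, A p -> forall e, 0 < e ->
    exists d, 0 < d /\ forall q, A q -> d1 p q < d -> Rabs (f q - f p) < e.

Definition pcont (A : pt -> Prop) (F : pt -> pt) : Prop :=
  rcont A (fun p => xc (F p)) /\ rcont A (fun p => yc (F p)) /\ rcont A (fun p => tc (F p)).

Lemma rcont_sub (A B : pt -> Prop) f : rcont B f -> (forall z, A z -> B z) -> rcont A f.
Proof.
  intros H AB p Hp e He. destruct (H p (AB p Hp) e He) as [d [Hd Ed]].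
  exists d. split; [exact Hd|]. intros q Aq. apply Ed. now apply AB.
Qed.

Lemma rcont_const A c : rcont A (fun _ => c).
Proof. intros p _ e He. exists 1. split; [lra|]. intros. rewrite Rminus_diag, Rabs_R0. lra. Qed.

Lemma rcont_xc A : rcont A (fun p => xc p).
Proof.
  intros p _ e He. exists e. split; [lra|]. intros q _ H. destruct (d1_coord q p) as [E _].
  rewrite d1_sym in H. lra.
Qed.

Lemma rcont_yc A : rcont A (fun p => yc p).
Proof.
  intros p _ e He. exists e. split; [lra|]. intros q _ H. destruct (d1_coord q p) as [_ [E _]].
  rewrite d1_sym in H. lra.
Qed.

Lemma rcont_tc A : rcont A (fun p => tc p).
Proof.
  intros p _ e He. exists e. split; [lra|]. intros q _ H. destruct (d1_coord q p) as [_ [_ E]].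
  rewrite d1_sym in H. lra.
Qed.

Lemma rcont_plus A f g : rcont A f -> rcont A g -> rcont A (fun p => f p + g p).
Proof.
  intros Hf Hg p Hp e He. destruct (Hf p Hp (e / 2)) as [d [Hd Ed]]; [lra|].
  destruct (Hg p Hp (e / 2)) as [d' [Hd' Ed']]; [lra|].
  exists (Rmin d d'). split; [now apply Rmin_glb_lt|]. intros q Aq Hq.
  specialize (Ed q Aq (Rlt_le_trans _ _ _ Hq (Rmin_l _ _))).
  specialize (Ed' q Aq (Rlt_le_trans _ _ _ Hq (Rmin_r _ _))).
  replace (f q + g q - (f p + g p)) with ((f q - f p) + (g q - g p)) by ring.
  eapply Rle_lt_trans; [apply Rabs_triang|]. lra.
Qed.

Lemma rcont_comp1 A f (g : R -> R) :
  rcont A f -> (forall p, A p -> continuity_pt g (f p)) -> rcont A (fun p => g (f p)).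
Proof.
  intros Hf Hg p Hp e He. destruct (Hg p Hp e He) as [a [Ha Ea]].
  destruct (Hf p Hp a Ha) as [d [Hd Ed]]. exists d. split; [exact Hd|]. intros q Aq Hq.
  destruct (Req_dec (f q) (f p)) as [E|E].
  - rewrite E, Rminus_diag, Rabs_R0. exact He.
  - apply (Ea (f q)). split.
    + split; [exact I|congruence].
    + apply (Ed q Aq Hq).
Qed.

Lemma rcont_opp A f : rcont A f -> rcont A (fun p => - f p).
Proof.
  intros Hf. apply (rcont_comp1 A f Ropp Hf). intros p _.
  apply (continuity_pt_opp id), derivable_continuous_pt, derivable_pt_id.
Qed.

Lemma rcont_minus A f g : rcont A f -> rcont A g -> rcont A (fun p => f p - g p).
Proof. intros Hf Hg. apply (rcont_plus A f (fun p => - g p) Hf), rcont_opp, Hg. Qed.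

Lemma rcont_pow A f n : rcont A f -> rcont A (fun p => f p ^ n).
Proof.
  intros Hf. apply (rcont_comp1 A f (fun x => x ^ n) Hf). intros p _.
  apply derivable_continuous_pt, derivable_pt_pow.
Qed.

Lemma rcont_ext A f g : (forall p, A p -> f p = g p) -> rcont A f -> rcont A g.
Proof.
  intros E Hf p Hp e He. destruct (Hf p Hp e He) as [d [Hd Ed]]. exists d. split; [exact Hd|].
  intros q Aq Hq. rewrite <- !E by assumption. now apply Ed.
Qed.

Lemma rcont_scal A c f : rcont A f -> rcont A (fun p => c * f p).
Proof.
  intros Hf. apply (rcont_comp1 A f (fun x => c * x) Hf). intros p _.
  apply (continuity_pt_scal id), derivable_continuous_pt, derivable_pt_id.
Qed.

(** Polarization reduces products to squares, hence to composition with functions of one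
    variable. *)
Lemma rcont_mult A f g : rcont A f -> rcont A g -> rcont A (fun p => f p * g p).
Proof.
  intros Hf Hg.
  apply (rcont_ext A (fun p => / 4 * ((f p + g p) ^ 2 - (f p - g p) ^ 2))).
  { intros. field. }
  apply rcont_scal, rcont_minus; apply rcont_pow; [now apply rcont_plus|now apply rcont_minus].
Qed.

Lemma rcont_inv A f : rcont A f -> (forall p, A p -> f p <> 0) -> rcont A (fun p => / f p).
Proof.
  intros Hf H. apply (rcont_comp1 A f Rinv Hf). intros p Hp.
  apply (continuity_pt_inv id); [apply derivable_continuous_pt, derivable_pt_id|now apply H].
Qed.

Lemma rcont_div A f g : rcont A f -> rcont A g -> (forall p, A p -> g p <> 0) ->
  rcont A (fun p => f p / g p).
Proof. intros Hf Hg H. apply rcont_mult; [exact Hf|now apply rcont_inv]. Qed.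

Lemma rcont_sqrt A f : rcont A f -> (forall p, A p -> 0 <= f p) -> rcont A (fun p => sqrt (f p)).
Proof. intros Hf H. apply (rcont_comp1 A f sqrt Hf). intros p Hp. apply continuity_pt_sqrt. now apply H. Qed.

Lemma rcont_abs A f : rcont A f -> rcont A (fun p => Rabs (f p)).
Proof. intros Hf. apply (rcont_comp1 A f Rabs Hf). intros p _. apply Rcontinuity_abs. Qed.

Lemma rcont_max A f g : rcont A f -> rcont A g -> rcont A (fun p => Rmax (f p) (g p)).
Proof.
  intros Hf Hg. apply (rcont_ext A (fun p => / 2 * (f p + g p + Rabs (f p - g p)))).
  - intros p _. unfold Rmax. destruct (Rle_dec (f p) (g p)).
    + rewrite Rabs_left1 by lra. lra.
    + rewrite Rabs_right by lra. lra.
  - apply rcont_scal, rcont_plus; [now apply rcont_plus|]. now apply rcont_abs, rcont_minus.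
Qed.

Lemma rcont_min A f g : rcont A f -> rcont A g -> rcont A (fun p => Rmin (f p) (g p)).
Proof.
  intros Hf Hg. apply (rcont_ext A (fun p => / 2 * (f p + g p - Rabs (f p - g p)))).
  - intros p _. unfold Rmin. destruct (Rle_dec (f p) (g p)).
    + rewrite Rabs_left1 by lra. lra.
    + rewrite Rabs_right by lra. lra.
  - apply rcont_scal, rcont_minus; [now apply rcont_plus|]. now apply rcont_abs, rcont_minus.
Qed.

Lemma pcont_d1 A F : pcont A F <->
  (forall p, A p -> forall e, 0 < e ->
    exists d, 0 < d /\ forall q, A q -> d1 p q < d -> d1 (F p) (F q) < e).
Proof.
  split.
  - intros [Hx [Hy Ht]] p Hp e He.
    destruct (Hx p Hp (e / 3)) as [a [Ha Ea]]; [lra|].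
    destruct (Hy p Hp (e / 3)) as [b [Hb Eb]]; [lra|].
    destruct (Ht p Hp (e / 3)) as [c [Hc Ec]]; [lra|].
    exists (Rmin a (Rmin b c)). split; [repeat apply Rmin_glb_lt; assumption|].
    intros q Aq Hq.
    pose proof (Rmin_l a (Rmin b c)). pose proof (Rmin_r a (Rmin b c)).
    pose proof (Rmin_l b c). pose proof (Rmin_r b c).
    specialize (Ea q Aq ltac:(lra)). specialize (Eb q Aq ltac:(lra)).
    specialize (Ec q Aq ltac:(lra)). rewrite d1_sym. unfold d1. simpl in *. lra.
  - intros H. repeat split; intros p Hp e He; destruct (H p Hp e He) as [d [Hd Ed]];
      exists d; (split; [exact Hd|]); intros q Aq Hq; specialize (Ed q Aq Hq);
      rewrite d1_sym in Ed; destruct (d1_coord (F q) (F p)) as [? [? ?]]; lra.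
Qed.

Lemma pcont_continuous_on A F : pcont A F <-> continuous_on A F.
Proof.
  rewrite pcont_d1. split; intros H p Hp e He.
  - destruct (H p Hp e He) as [d [Hd Ed]]. exists (d / 2). split; [lra|].
    intros q Aq Hq. pose proof (dist_le_d1 (F p) (F q)). pose proof (d1_le_dist p q).
    specialize (Ed q Aq ltac:(lra)). lra.
  - destruct (H p Hp (e / 2)) as [d [Hd Ed]]; [lra|]. exists d. split; [lra|].
    intros q Aq Hq. pose proof (d1_le_dist (F p) (F q)). pose proof (dist_le_d1 p q).
    specialize (Ed q Aq ltac:(lra)). lra.
Qed.

Lemma rcont_comp A B F f : rcont B f -> pcont A F -> (forall p, A p -> B (F p)) ->
  rcont A (fun p => f (F p)).
Proof.
  rewrite pcont_d1. intros Hf HF AB p Hp e He.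
  destruct (Hf (F p) (AB p Hp) e He) as [a [Ha Ea]].
  destruct (HF p Hp a Ha) as [d [Hd Ed]]. exists d. split; [exact Hd|].
  intros q Aq Hq. apply Ea; [now apply AB|now apply Ed].
Qed.

Lemma pcont_comp A B F G : pcont B G -> pcont A F -> (forall p, A p -> B (F p)) ->
  pcont A (fun p => G (F p)).
Proof.
  intros [Hx [Hy Ht]] HF AB.
  repeat split; [apply (rcont_comp A B F (fun p => xc (G p)))
    |apply (rcont_comp A B F (fun p => yc (G p)))
    |apply (rcont_comp A B F (fun p => tc (G p)))]; assumption.
Qed.

Lemma pcont_pair A f g h : rcont A f -> rcont A g -> rcont A h ->
  pcont A (fun p => (f p, g p, h p)).
Proof. intros; repeat split; assumption. Qed.

Lemma pcont_sub A B F : pcont B F -> (forall p, A p -> B p) -> pcont A F.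
Proof.
  rewrite !pcont_d1. intros H AB p Hp e He. destruct (H p (AB p Hp) e He) as [d [Hd Ed]].
  exists d. split; [exact Hd|]. intros q Aq. apply Ed. now apply AB.
Qed.

Ltac rcont_auto := repeat first
  [ assumption | apply rcont_const | apply rcont_xc | apply rcont_yc | apply rcont_tc
  | apply rcont_plus | apply rcont_minus | apply rcont_opp | apply rcont_div
  | apply rcont_mult | apply rcont_pow | apply rcont_sqrt | apply rcont_abs
  | apply rcont_max | apply rcont_min ].

(** * Constancy of sign along segments *)

Definition lerp (p q : pt) (s : R) : pt :=
  ((1 - s) * xc p + s * xc q, (1 - s) * yc p + s * yc q, (1 - s) * tc p + s * tc q).

Lemma lerp0 p q : lerp p q 0 = p.
Proof. rewrite (pt_eta p) at 2. unfold lerp. repeat f_equal; ring. Qed.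

Lemma lerp1 p q : lerp p q 1 = q.
Proof. rewrite (pt_eta q) at 2. unfold lerp. repeat f_equal; ring. Qed.

Lemma d1_lerp p q s s' : d1 (lerp p q s) (lerp p q s') = Rabs (s - s') * d1 p q.
Proof.
  unfold d1, lerp. cbn [xc yc tc fst snd].
  assert (E : forall a b, Rabs ((1 - s) * a + s * b - ((1 - s') * a + s' * b))
    = Rabs (s - s') * Rabs (a - b)).
  { intros a b. rewrite (Rabs_minus_sym a b), <- Rabs_mult. f_equal. ring. }
  unfold xc, yc, tc; simpl fst; simpl snd. rewrite !E. ring.
Qed.

(** [IVT] asks for continuity on the whole line; clamping the parameter prolongs a segment by
    constants beyond its ends. *)
Definition clamp (s : R) : R := Rmax 0 (Rmin 1 s).

Lemma clamp_bounds s : 0 <= clamp s <= 1.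
Proof. unfold clamp, Rmax, Rmin. repeat destruct Rle_dec; lra. Qed.

Lemma clamp_id s : 0 <= s <= 1 -> clamp s = s.
Proof. unfold clamp, Rmax, Rmin. repeat destruct Rle_dec; lra. Qed.

Lemma clamp_lip s s' : Rabs (clamp s - clamp s') <= Rabs (s - s').
Proof.
  unfold clamp, Rmax, Rmin, Rabs. repeat destruct Rle_dec; repeat destruct Rcase_abs; lra.
Qed.

Lemma segment_sign (A : pt -> Prop) (f : pt -> R) (p q : pt) :
  rcont A f -> (forall z, A z -> f z <> 0) ->
  (forall s, 0 <= s <= 1 -> A (lerp p q s)) -> 0 < f p -> 0 < f q.
Proof.
  intros Hf Hn HA Hp.
  destruct (Rlt_or_le 0 (f q)) as [H|H]; [exact H|exfalso].
  assert (Ap : A p) by (rewrite <- (lerp0 p q); apply HA; lra).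
  assert (Aq : A q) by (rewrite <- (lerp1 p q); apply HA; lra).
  assert (Hq : f q < 0) by (specialize (Hn q Aq); lra).
  (* The sign is reversed because [IVT] wants a negative value at the left end and a positive one at
     the right end. *)
  set (g := fun s => - f (lerp p q (clamp s))).
  assert (Cg : continuity g).
  { intros s. apply (continuity_pt_opp (fun s => f (lerp p q (clamp s)))).
    intros e He.
    destruct (Hf _ (HA _ (clamp_bounds s)) e He) as [d [Hd Ed]].
    (* The added 1 covers the degenerate segment [p = q]. *)
    assert (HD : 0 < d / (d1 p q + 1)).
    { pose proof (d1_pos p q). apply Rdiv_lt_0_compat; lra. }
    exists (d / (d1 p q + 1)). split; [exact HD|].
    intros s' [_ Hs']. unfold dist in *; simpl in *. unfold Rdist in *.
    apply Ed; [apply HA, clamp_bounds|]. rewrite d1_lerp.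
    pose proof (d1_pos p q). pose proof (clamp_lip s s'). rewrite Rabs_minus_sym in Hs'.
    pose proof (Rabs_pos (clamp s - clamp s')).
    apply Rle_lt_trans with (Rabs (s - s') * (d1 p q + 1)).
    - pose proof (Rabs_pos (s - s')). nra.
    - apply (Rmult_lt_compat_r (d1 p q + 1)) in Hs'; [|lra].
      unfold Rdiv in Hs'. rewrite Rmult_assoc, Rinv_l, Rmult_1_r in Hs' by lra. exact Hs'. }
  destruct (IVT g 0 1 Cg) as [z [Hz Ez]]; try lra; unfold g in *.
  - rewrite clamp_id, lerp0 by lra. lra.
  - rewrite clamp_id, lerp1 by lra. lra.
  - apply (Hn (lerp p q (clamp z))); [apply HA, clamp_bounds|]. lra.
Qed.

(** * The pieces of the surfaces *)

Definition loop (k : nat) (p : pt) : Prop := quartic k (xc p) (yc p) (tc p) = 0 /\ 0 <= tc p.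

Definition tube (a b : R) (p : pt) : Prop :=
  (xc p - a * tc p) ^ 2 + (yc p - b * tc p) ^ 2 = tc p ^ 2 / 16 /\ 0 <= tc p.

Lemma X1_pieces k p : X1 k p <-> loop k p \/ tube 1 (1 / 2) p \/ tube 1 (- 1 / 2) p.
Proof.
  destruct p as [[x y] t]. unfold X1, loop, tube, xc, yc, tc; simpl fst; simpl snd.
  split.
  - intros [H Ht]. apply Rmult_integral in H. destruct H as [H|H].
    + apply Rmult_integral in H. destruct H as [H|H]; [now left|right; left].
      split; [|exact Ht]. replace (1 * t) with t by ring. replace (1 / 2 * t) with (t / 2) by field. lra.
    + right; right. split; [|exact Ht]. replace (y - - 1 / 2 * t) with (y + t / 2) by field.
      replace (1 * t) with t by ring. lra.
  - intros [[H Ht]|[[H Ht]|[H Ht]]]; (split; [|exact Ht]).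
    + rewrite H. ring.
    + replace ((x - t) ^ 2 + (y - t / 2) ^ 2 - t ^ 2 / 16) with 0; [ring|].
      rewrite <- H. field.
    + replace ((x - t) ^ 2 + (y + t / 2) ^ 2 - t ^ 2 / 16) with 0; [ring|].
      rewrite <- H. field.
Qed.

Lemma X2_pieces k p : X2 k p <-> loop k p \/ tube 1 0 p \/ tube (-1) 0 p.
Proof.
  destruct p as [[x y] t]. unfold X2, loop, tube, xc, yc, tc; simpl fst; simpl snd.
  split.
  - intros [H Ht]. apply Rmult_integral in H. destruct H as [H|H].
    + apply Rmult_integral in H. destruct H as [H|H]; [now left|right; left].
      split; [|exact Ht]. replace (1 * t) with t by ring. replace (y - 0 * t) with y by ring. lra.
    + right; right. split; [|exact Ht]. replace (x - -1 * t) with (x + t) by ring.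
      replace (y - 0 * t) with y by ring. lra.
  - intros [[H Ht]|[[H Ht]|[H Ht]]]; (split; [|exact Ht]).
    + rewrite H. ring.
    + replace ((x - t) ^ 2 + y ^ 2 - t ^ 2 / 16) with 0; [ring|].
      rewrite <- H. field.
    + replace ((x + t) ^ 2 + y ^ 2 - t ^ 2 / 16) with 0; [ring|].
      rewrite <- H. field.
Qed.

Lemma sq_le_abs a b : 0 <= b -> a ^ 2 <= b ^ 2 -> - b <= a <= b.
Proof. intros. split; nra. Qed.

Lemma tube_bounds a b p : tube a b p ->
  - (tc p / 4) <= xc p - a * tc p <= tc p / 4 /\ - (tc p / 4) <= yc p - b * tc p <= tc p / 4.
Proof.
  intros [H Ht]. split; apply sq_le_abs; try lra;
    pose proof (pow2_ge_0 (xc p - a * tc p)); pose proof (pow2_ge_0 (yc p - b * tc p)); lra.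
Qed.

(** The two factors of the quartic are the powers of the point with respect to the circles of radius
    [t] about [(t, 0)] and [(-t, 0)]. On the loop their product [t^k] is nonnegative and their sum
    is always nonnegative, so both are nonnegative. *)
Lemma loop_outside k p : loop k p ->
  tc p ^ 2 <= (xc p - tc p) ^ 2 + yc p ^ 2 /\ tc p ^ 2 <= (xc p + tc p) ^ 2 + yc p ^ 2.
Proof.
  intros [H Ht]. unfold quartic in H. set (x := xc p) in *. set (y := yc p) in *. set (t := tc p) in *.
  pose proof (pow_le t k Ht) as Hk.
  pose proof (pow2_ge_0 x). pose proof (pow2_ge_0 y).
  set (P := x ^ 2 - 2 * x * t + y ^ 2) in *. set (N := x ^ 2 + 2 * x * t + y ^ 2) in *.
  assert (HS : 0 <= P + N) by (unfold P, N; nra).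
  assert (HP : 0 <= P * N) by lra.
  assert (E1 : (x - t) ^ 2 + y ^ 2 = P + t ^ 2) by (unfold P; ring).
  assert (E2 : (x + t) ^ 2 + y ^ 2 = N + t ^ 2) by (unfold N; ring).
  rewrite E1, E2.
  destruct (Rle_or_lt 0 P) as [HP0|HP0]; destruct (Rle_or_lt 0 N) as [HN0|HN0]; try lra.
  - assert (P * N <= 0) by nra. assert (P * N = 0) by lra.
    assert (P = 0) by nra. lra.
  - assert (P * N <= 0) by nra. assert (P * N = 0) by lra.
    assert (N = 0) by nra. lra.
Qed.

(** At one height the loop avoids a disc of radius [t] while [q] is within [3/4 t] of its centre. A
    difference of heights moves centre and radius by at most [d1 p q] in all, which gives
    [tc q / 4 <= 2 d1 p q]. *)
Lemma loop_separation k p q e : loop k p -> e = 1 \/ e = -1 -> 0 <= tc q ->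
  (xc q - e * tc q) ^ 2 + yc q ^ 2 <= (3 / 4 * tc q) ^ 2 -> tc q <= 8 * d1 p q.
Proof.
  intros HQ He Ht Hq.
  assert (Hp : tc p ^ 2 <= (xc p - e * tc p) ^ 2 + yc p ^ 2).
  { destruct (loop_outside k p HQ) as [H1 H2]. destruct He; subst e.
    - now replace (xc p - 1 * tc p) with (xc p - tc p) by ring.
    - now replace (xc p - -1 * tc p) with (xc p + tc p) by ring. }
  destruct HQ as [_ Htp].
  set (N := 3 / 4 * tc q) in *. assert (HN : 0 <= N) by (unfold N; lra).
  set (a := xc q - e * tc q) in *. set (b := yc q) in *.
  set (u := (xc p - e * tc p) - a). set (v := yc p - b).
  assert (Ha : - N <= a <= N) by (apply sq_le_abs; [lra|]; pose proof (pow2_ge_0 b); lra).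
  assert (Hb : - N <= b <= N) by (apply sq_le_abs; [lra|]; pose proof (pow2_ge_0 a); lra).
  set (D := Rabs u + Rabs v).
  assert (Hu : - Rabs u <= u <= Rabs u) by (unfold Rabs; destruct Rcase_abs; lra).
  assert (Hv : - Rabs v <= v <= Rabs v) by (unfold Rabs; destruct Rcase_abs; lra).
  pose proof (Rabs_pos u) as Pu. pose proof (Rabs_pos v) as Pv.
  assert (HD : tc p <= N + D).
  { apply Rnot_lt_le. intros HH.
    replace (xc p - e * tc p) with (a + u) in Hp by (unfold u; ring).
    replace (yc p) with (b + v) in Hp by (unfold v; ring).
    assert (a * u <= N * Rabs u) by nra. assert (b * v <= N * Rabs v) by nra.
    assert (u ^ 2 = Rabs u ^ 2) by (symmetry; apply pow2_abs).
    assert (v ^ 2 = Rabs v ^ 2) by (symmetry; apply pow2_abs).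
    assert ((a + u) ^ 2 + (b + v) ^ 2 <= (N + D) ^ 2) by (unfold D; nra).
    unfold D in *. nra. }
  assert (HDd : D <= d1 p q).
  { unfold D, d1. fold v. assert (Rabs u <= Rabs (xc p - xc q) + Rabs (tc p - tc q)); [|unfold v, b in *; lra].
    unfold u, a. replace (xc p - e * tc p - (xc q - e * tc q)) with ((xc p - xc q) + - (e * (tc p - tc q))) by ring.
    eapply Rle_trans; [apply Rabs_triang|]. apply Rplus_le_compat_l. rewrite Rabs_Ropp, Rabs_mult.
    destruct He; subst e.
    - rewrite Rabs_R1. lra.
    - rewrite (Rabs_left (-1)) by lra. lra. }
  destruct (d1_coord p q) as [_ [_ Htt]].
  assert (tc q - tc p <= d1 p q) by (eapply Rle_trans; [|exact Htt]; unfold Rabs; destruct Rcase_abs; lra).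
  unfold N in *. lra.
Qed.

(** The first [3/4] is [1/2 + 1/4], the offset of the centre plus the radius; the second is
    [1 - 1/4]. *)
Lemma tube_in_lobe a b p e : tube a b p -> e = 1 \/ e = -1 -> a = e -> - (1 / 2) <= b <= 1 / 2 ->
  (xc p - e * tc p) ^ 2 + yc p ^ 2 <= (3 / 4 * tc p) ^ 2 /\ 3 / 4 * tc p <= e * xc p.
Proof.
  intros HT He -> Hb. destruct (tube_bounds _ _ _ HT) as [Hx Hy]. destruct HT as [H Ht].
  set (X := xc p - e * tc p) in *. set (Y := yc p - b * tc p) in *.
  assert (Ey : yc p = Y + b * tc p) by (unfold Y; ring).
  assert (Ex : xc p = X + e * tc p) by (unfold X; ring).
  split.
  - rewrite Ey. assert (- (tc p / 2) <= b * tc p <= tc p / 2) by nra. nra.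
  - rewrite Ex. destruct He; subst e; lra.
Qed.

(* The sign of [quartic + t^4 / 2] tells the loop from the tubes. *)
Lemma lobe_quartic_neg k p e : e = 1 \/ e = -1 -> 0 < tc p ->
  (xc p - e * tc p) ^ 2 + yc p ^ 2 <= (3 / 4 * tc p) ^ 2 -> 3 / 4 * tc p <= e * xc p ->
  quartic k (xc p) (yc p) (tc p) + tc p ^ 4 / 2 < 0.
Proof.
  intros He Ht H Hx. unfold quartic. pose proof (pow_lt _ k Ht) as Hk.
  set (x := xc p) in *. set (y := yc p) in *. set (t := tc p) in *.
  assert (K : forall z, 3 / 4 * t <= z -> (z - t) ^ 2 + y ^ 2 <= (3 / 4 * t) ^ 2 ->
     (z ^ 2 - 2 * z * t + y ^ 2) * (z ^ 2 + 2 * z * t + y ^ 2) + t ^ 4 / 2 <= 0).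
  (* Here [7/16 = 1 - (3/4)^2], and [3/2] comes from the term [2 z t] alone; the product [21/32]
     exceeds the required [1/2]. *)
  { intros z Hz H'. assert (z ^ 2 - 2 * z * t + y ^ 2 <= - (7 / 16 * t ^ 2)) by nra.
    assert (3 / 2 * t ^ 2 <= z ^ 2 + 2 * z * t + y ^ 2) by nra.
    assert (0 < t ^ 2) by nra.
    replace (t ^ 4) with (t ^ 2 * t ^ 2) by ring.
    set (P := z ^ 2 - 2 * z * t + y ^ 2) in *. set (N := z ^ 2 + 2 * z * t + y ^ 2) in *.
    set (s := t ^ 2) in *. nra. }
  destruct He; subst e.
  - specialize (K x ltac:(lra)). replace (x - 1 * t) with (x - t) in H by ring. specialize (K H). lra.
  - specialize (K (- x) ltac:(lra)). replace ((- x - t) ^ 2) with ((x - - 1 * t) ^ 2) in K by ring.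
    specialize (K H).
    replace ((- x) ^ 2 - 2 * - x * t + y ^ 2) with (x ^ 2 + 2 * x * t + y ^ 2) in K by ring.
    replace ((- x) ^ 2 + 2 * - x * t + y ^ 2) with (x ^ 2 - 2 * x * t + y ^ 2) in K by ring.
    lra.
Qed.

Lemma loop_0 k p : loop k p -> tc p = 0 -> (0 < k)%nat -> p = origin.
Proof.
  intros [H _] Ht Hk. unfold quartic in H. rewrite Ht in H. rewrite (pow_i k Hk) in H.
  assert (E : xc p ^ 2 + yc p ^ 2 = 0).
  { apply (Rsqr_0_uniq (xc p ^ 2 + yc p ^ 2)). unfold Rsqr. rewrite <- H. ring. }
  rewrite (pt_eta p), Ht. unfold origin. repeat f_equal; nra.
Qed.

Lemma tube_0 a b p : tube a b p -> tc p = 0 -> p = origin.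
Proof.
  intros H Ht. destruct (tube_bounds _ _ _ H). rewrite Ht in *. rewrite (pt_eta p), Ht.
  unfold origin. repeat f_equal; lra.
Qed.

Lemma tc_not_origin p : 0 < tc p -> p <> origin.
Proof. intros Ht ->. unfold tc, origin in Ht; simpl in Ht. lra. Qed.

Lemma loop_origin k : (0 < k)%nat -> loop k origin.
Proof.
  intros Hk. unfold loop, quartic, origin, xc, yc, tc; simpl fst; simpl snd.
  rewrite (pow_i k Hk). split; [ring|lra].
Qed.

(** * Outer bi-Lipschitz equivalence *)

Definition shift (a b : R) (p : pt) : pt := (xc p + a * tc p, yc p + b * tc p, tc p).

Lemma shift_lip a b p q : d1 (shift a b p) (shift a b q) <= (1 + Rabs a + Rabs b) * d1 p q.
Proof.
  unfold d1, shift, xc, yc, tc; simpl fst; simpl snd. destruct p as [[x y] t], q as [[x' y'] t'].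
  simpl fst; simpl snd.
  assert (E : forall c u u', Rabs (u + c * t - (u' + c * t')) <= Rabs (u - u') + Rabs c * Rabs (t - t')).
  { intros. rewrite <- Rabs_mult. replace (u + c * t - (u' + c * t')) with ((u - u') + c * (t - t')) by ring.
    apply Rabs_triang. }
  pose proof (E a x x'). pose proof (E b y y').
  pose proof (Rabs_pos a). pose proof (Rabs_pos b). pose proof (Rabs_pos (x - x')).
  pose proof (Rabs_pos (y - y')). nra.
Qed.

Lemma shift_near a b p : 0 <= tc p -> d1 p (shift a b p) <= (Rabs a + Rabs b) * tc p.
Proof.
  intros Ht. unfold d1, shift, xc, yc, tc in *; simpl fst; simpl snd. destruct p as [[x y] t].
  simpl fst in *; simpl snd in *.
  replace (x - (x + a * t)) with (- (a * t)) by ring.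
  replace (y - (y + b * t)) with (- (b * t)) by ring.
  rewrite !Rabs_Ropp, !Rabs_mult, Rminus_diag, Rabs_R0, (Rabs_right t) by lra. lra.
Qed.

(* The pieces of the surface have mutual distance comparable with [t], so a map
   acting by a shift on each of them is Lipschitz. *)
Lemma pieces_lip (k : nat) (A B : pt -> Prop) (a b a' b' : R) (h : pt -> pt) :
  (forall p, A p -> 0 <= tc p /\ exists e, (e = 1 \/ e = -1) /\
     (xc p - e * tc p) ^ 2 + yc p ^ 2 <= (3 / 4 * tc p) ^ 2) ->
  (forall p, B p -> 0 <= tc p /\ exists e, (e = 1 \/ e = -1) /\
     (xc p - e * tc p) ^ 2 + yc p ^ 2 <= (3 / 4 * tc p) ^ 2) ->
  (forall p q, A p -> B q -> tc p + tc q <= 4 * d1 p q) ->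
  Rabs a + Rabs b <= 5 / 2 -> Rabs a' + Rabs b' <= 5 / 2 ->
  (forall p, loop k p -> h p = p) ->
  (forall p, A p -> h p = shift a b p) -> (forall p, B p -> h p = shift a' b' p) ->
  forall p q, loop k p \/ A p \/ B p -> loop k q \/ A q \/ B q -> d1 (h p) (h q) <= 21 * d1 p q.
Proof.
  intros HA HB HAB Sa Sb hL hA hB.
  assert (NA : forall p, A p -> d1 p (h p) <= 5 / 2 * tc p).
  { intros p Ap. rewrite hA by exact Ap. destruct (HA p Ap) as [Ht _].
    pose proof (shift_near a b p Ht). nra. }
  assert (NB : forall p, B p -> d1 p (h p) <= 5 / 2 * tc p).
  { intros p Ap. rewrite hB by exact Ap. destruct (HB p Ap) as [Ht _].
    pose proof (shift_near a' b' p Ht). nra. }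
  assert (T : forall p q, d1 (h p) (h q) <= d1 p (h p) + d1 p q + d1 q (h q)).
  { intros p q. pose proof (d1_triangle (h p) p (h q)). pose proof (d1_triangle p q (h q)).
    rewrite (d1_sym (h p) p) in *. lra. }
  (* The shift moves [q] by at most [5/2 tc q], and [tc q <= 8 d1 p q], whence [21 = 1 + 5/2 * 8].
     The bound [5/2] is the size of the longer shift, [2 + 1/2]. *)
  assert (LA : forall p q, loop k p -> A q -> d1 (h p) (h q) <= 21 * d1 p q).
  { intros p q Lp Aq. destruct (HA q Aq) as [Ht [e [He Hq]]].
    pose proof (loop_separation k p q e Lp He Ht Hq). specialize (NA q Aq). specialize (T p q).
    rewrite (hL p Lp), d1_refl in T. rewrite (hL p Lp). lra. }
  assert (LB : forall p q, loop k p -> B q -> d1 (h p) (h q) <= 21 * d1 p q).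
  { intros p q Lp Aq. destruct (HB q Aq) as [Ht [e [He Hq]]].
    pose proof (loop_separation k p q e Lp He Ht Hq). specialize (NB q Aq). specialize (T p q).
    rewrite (hL p Lp), d1_refl in T. rewrite (hL p Lp). lra. }
  assert (AB : forall p q, A p -> B q -> d1 (h p) (h q) <= 21 * d1 p q).
  { intros p q Ap Bq. pose proof (HAB p q Ap Bq). specialize (NA p Ap). specialize (NB q Bq).
    specialize (T p q). pose proof (d1_pos p q). lra. }
  intros p q [Lp|[Ap|Bp]] [Lq|[Aq|Bq]]; auto; pose proof (d1_pos p q).
  - rewrite !hL by assumption. lra.
  - rewrite (d1_sym (h p)), (d1_sym p). auto.
  - rewrite !hA by assumption. pose proof (shift_lip a b p q). nra.
  - rewrite (d1_sym (h p)), (d1_sym p). auto.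
  - rewrite (d1_sym (h p)), (d1_sym p). auto.
  - rewrite !hB by assumption. pose proof (shift_lip a' b' p q). nra.
Qed.

Lemma tube_in_some_lobe a b p : tube a b p -> a = 1 \/ a = -1 -> - (1 / 2) <= b <= 1 / 2 ->
  0 <= tc p /\ exists e, (e = 1 \/ e = -1) /\
     (xc p - e * tc p) ^ 2 + yc p ^ 2 <= (3 / 4 * tc p) ^ 2.
Proof.
  intros H Ha Hb. split; [apply H|]. exists a. split; [exact Ha|].
  now apply (tube_in_lobe a b).
Qed.

Lemma tube_shift a b c d p : tube a b p -> tube (a + c) (b + d) (shift c d p).
Proof.
  unfold tube, shift, xc, yc, tc; simpl fst; simpl snd. intros [H Ht]. split; [|exact Ht].
  rewrite <- H. ring.
Qed.

Lemma shift_shift a b c d p : a + c = 0 -> b + d = 0 -> shift a b (shift c d p) = p.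
Proof.
  intros Ha Hb. rewrite (pt_eta p) at 2. unfold shift, xc, yc, tc; simpl fst; simpl snd.
  replace a with (- c) by lra. replace b with (- d) by lra. repeat f_equal; ring.
Qed.

Lemma tube_pos a b p : tube a b p -> p <> origin -> 0 < tc p.
Proof.
  intros H Hp. destruct (Req_dec (tc p) 0) as [Z|Z]; [|destruct H; lra].
  exfalso. apply Hp. now apply (tube_0 a b).
Qed.

Lemma tube_not_loop k a b p : a = 1 \/ a = -1 -> - (1 / 2) <= b <= 1 / 2 -> tube a b p -> p <> origin ->
  quartic k (xc p) (yc p) (tc p) <> 0.
Proof.
  intros Ha Hb H Hp E.
  pose proof (tube_pos a b p H Hp) as Ht.
  destruct (tube_in_lobe a b p a H Ha eq_refl Hb) as [H1 H2].
  pose proof (lobe_quartic_neg k p a Ha Ht H1 H2). pose proof (pow_lt _ 4 Ht). lra.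
Qed.

(** A tube meets the loop only at the origin, which every shift fixes, so testing [quartic] first is
    consistent. Off the loop the sign of [y] separates the tubes of [X1]; for [gather] the sign of
    [x] separates those of [X2]. *)
Definition spread (k : nat) (p : pt) : pt :=
  if Req_EM_T (quartic k (xc p) (yc p) (tc p)) 0 then p
  else if Rlt_dec 0 (yc p) then shift 0 (- (1 / 2)) p else shift (-2) (1 / 2) p.

Definition gather (k : nat) (p : pt) : pt :=
  if Req_EM_T (quartic k (xc p) (yc p) (tc p)) 0 then p
  else if Rlt_dec 0 (xc p) then shift 0 (1 / 2) p else shift 2 (- (1 / 2)) p.

Lemma shift_origin a b : shift a b origin = origin.
Proof. unfold shift, origin, xc, yc, tc; simpl fst; simpl snd. repeat f_equal; ring. Qed.

Lemma spread_loop k p : loop k p -> spread k p = p.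
Proof. intros [H _]. unfold spread. destruct Req_EM_T; [reflexivity|contradiction]. Qed.

Lemma gather_loop k p : loop k p -> gather k p = p.
Proof. intros [H _]. unfold gather. destruct Req_EM_T; [reflexivity|contradiction]. Qed.

Section Maps.
Context (k : nat) (hk : (0 < k)%nat).

Lemma spread_upper p : tube 1 (1 / 2) p -> spread k p = shift 0 (- (1 / 2)) p.
Proof.
  intros H. destruct (classic (p = origin)) as [->|Hp].
  { rewrite shift_origin. apply spread_loop, loop_origin, hk. }
  pose proof (tube_pos _ _ _ H Hp). destruct (tube_bounds _ _ _ H).
  unfold spread. destruct Req_EM_T as [E|_].
  - exfalso. revert E. apply (tube_not_loop k 1 (1 / 2)); auto; lra.
  - destruct Rlt_dec; [reflexivity|lra].
Qed.

Lemma spread_lower p : tube 1 (- 1 / 2) p -> spread k p = shift (-2) (1 / 2) p.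
Proof.
  intros H. destruct (classic (p = origin)) as [->|Hp].
  { rewrite shift_origin. apply spread_loop, loop_origin, hk. }
  pose proof (tube_pos _ _ _ H Hp). destruct (tube_bounds _ _ _ H).
  unfold spread. destruct Req_EM_T as [E|_].
  - exfalso. revert E. apply (tube_not_loop k 1 (- 1 / 2)); auto; lra.
  - destruct Rlt_dec; [lra|reflexivity].
Qed.

Lemma gather_right p : tube 1 0 p -> gather k p = shift 0 (1 / 2) p.
Proof.
  intros H. destruct (classic (p = origin)) as [->|Hp].
  { rewrite shift_origin. apply gather_loop, loop_origin, hk. }
  pose proof (tube_pos _ _ _ H Hp). destruct (tube_bounds _ _ _ H).
  unfold gather. destruct Req_EM_T as [E|_].
  - exfalso. revert E. apply (tube_not_loop k 1 0); auto; lra.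
  - destruct Rlt_dec; [reflexivity|lra].
Qed.

Lemma gather_left p : tube (-1) 0 p -> gather k p = shift 2 (- (1 / 2)) p.
Proof.
  intros H. destruct (classic (p = origin)) as [->|Hp].
  { rewrite shift_origin. apply gather_loop, loop_origin, hk. }
  pose proof (tube_pos _ _ _ H Hp). destruct (tube_bounds _ _ _ H).
  unfold gather. destruct Req_EM_T as [E|_].
  - exfalso. revert E. apply (tube_not_loop k (-1) 0); auto; lra.
  - destruct Rlt_dec; [lra|reflexivity].
Qed.

Lemma shift_upper p : tube 1 (1 / 2) p -> tube 1 0 (shift 0 (- (1 / 2)) p).
Proof. intros H. replace 1 with (1 + 0) at 1 by ring. replace 0 with (1 / 2 + - (1 / 2)) at 2 by ring. now apply tube_shift. Qed.

Lemma shift_lower p : tube 1 (- 1 / 2) p -> tube (-1) 0 (shift (-2) (1 / 2) p).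
Proof. intros H. replace (-1) with (1 + -2) by ring. replace 0 with (- 1 / 2 + 1 / 2) by field. now apply tube_shift. Qed.

Lemma shift_right p : tube 1 0 p -> tube 1 (1 / 2) (shift 0 (1 / 2) p).
Proof. intros H. replace 1 with (1 + 0) at 1 by ring. replace (1 / 2) with (0 + 1 / 2) at 1 by ring. now apply tube_shift. Qed.

Lemma shift_left p : tube (-1) 0 p -> tube 1 (- 1 / 2) (shift 2 (- (1 / 2)) p).
Proof. intros H. replace 1 with (-1 + 2) at 1 by ring. replace (- 1 / 2) with (0 + - (1 / 2)) by field. now apply tube_shift. Qed.

Lemma spread_maps p : X1 k p -> X2 k (spread k p) /\ gather k (spread k p) = p.
Proof.
  rewrite X1_pieces, X2_pieces. intros [H|[H|H]].
  - rewrite spread_loop by exact H. split; [now left|now apply gather_loop].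
  - rewrite spread_upper by exact H. apply shift_upper in H as H'. split; [now right; left|].
    rewrite gather_right by exact H'. apply shift_shift; lra.
  - rewrite spread_lower by exact H. apply shift_lower in H as H'. split; [now right; right|].
    rewrite gather_left by exact H'. apply shift_shift; lra.
Qed.

Lemma gather_maps p : X2 k p -> X1 k (gather k p) /\ spread k (gather k p) = p.
Proof.
  rewrite X1_pieces, X2_pieces. intros [H|[H|H]].
  - rewrite gather_loop by exact H. split; [now left|now apply spread_loop].
  - rewrite gather_right by exact H. apply shift_right in H as H'. split; [now right; left|].
    rewrite spread_upper by exact H'. apply shift_shift; lra.
  - rewrite gather_left by exact H. apply shift_left in H as H'. split; [now right; right|].
    rewrite spread_lower by exact H'. apply shift_shift; lra.
Qed.

Lemma spread_lip p q : X1 k p -> X1 k q -> d1 (spread k p) (spread k q) <= 21 * d1 p q.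
Proof.
  rewrite !X1_pieces.
  apply (pieces_lip k (tube 1 (1 / 2)) (tube 1 (- 1 / 2)) 0 (- (1 / 2)) (-2) (1 / 2)).
  - intros z H. apply (tube_in_some_lobe _ _ _ H); lra.
  - intros z H. apply (tube_in_some_lobe _ _ _ H); lra.
  - intros z w Hz Hw. destruct (tube_bounds _ _ _ Hz) as [_ ?]. destruct (tube_bounds _ _ _ Hw) as [_ ?].
    destruct (d1_coord z w) as [_ [E _]].
    rewrite Rabs_right in E; [lra|]. destruct Hz, Hw. lra.
  - unfold Rabs; repeat destruct Rcase_abs; lra.
  - unfold Rabs; repeat destruct Rcase_abs; lra.
  - apply spread_loop.
  - apply spread_upper.
  - apply spread_lower.
Qed.

Lemma gather_lip p q : X2 k p -> X2 k q -> d1 (gather k p) (gather k q) <= 21 * d1 p q.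
Proof.
  rewrite !X2_pieces.
  apply (pieces_lip k (tube 1 0) (tube (-1) 0) 0 (1 / 2) 2 (- (1 / 2))).
  - intros z H. apply (tube_in_some_lobe _ _ _ H); lra.
  - intros z H. apply (tube_in_some_lobe _ _ _ H); lra.
  - intros z w Hz Hw. destruct (tube_bounds _ _ _ Hz) as [? _]. destruct (tube_bounds _ _ _ Hw) as [? _].
    destruct (d1_coord z w) as [E _].
    rewrite Rabs_right in E; [|destruct Hz, Hw; lra]. destruct Hz, Hw. lra.
  - unfold Rabs; repeat destruct Rcase_abs; lra.
  - unfold Rabs; repeat destruct Rcase_abs; lra.
  - apply gather_loop.
  - apply gather_right.
  - apply gather_left.
Qed.

End Maps.

Lemma is_open_full : is_open (fun _ => True).
Proof. intros p _. exists 1. split; [lra|auto]. Qed.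

Lemma outer_equiv k : (0 < k)%nat -> bilip_outer_equiv (X1 k) (X2 k).
Proof.
  (* The constant is [21] times the factor 2 lost between [d1] and [dist]. *)
  intros hk. exists (fun _ => True), (fun _ => True), (spread k), (gather k), 42.
  repeat split; auto using is_open_full; try lra.
  - apply spread_loop, loop_origin, hk.
  - now apply spread_maps.
  - now apply gather_maps.
  - intros p H _. now apply spread_maps.
  - intros p H _. now apply gather_maps.
  - destruct H as [Hp _], H0 as [Hq _]. pose proof (spread_lip k hk p q Hp Hq).
    pose proof (dist_le_d1 (spread k p) (spread k q)). pose proof (d1_le_dist p q). lra.
  - destruct H as [Hp _], H0 as [Hq _].
    destruct (spread_maps k hk p Hp) as [Yp Ep]. destruct (spread_maps k hk q Hq) as [Yq Eq].
    pose proof (gather_lip k hk _ _ Yp Yq) as G. rewrite Ep, Eq in G.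
    pose proof (dist_le_d1 p q). pose proof (d1_le_dist (spread k p) (spread k q)). lra.
Qed.

(** * Ambient topological equivalence *)

(* [push_left t c x = x - max 0 (min (2 t) (8/9 (x + 3/2 t)) (8 (3/2 t - x)) c)], written as
   a min-max of increasing affine functions of [x] so that its inverse is the max-min of
   their inverses; similarly for [push_down]. *)
Definition push_left (t c x : R) : R :=
  Rmin x (Rmax (Rmax (x - 2 * t) (x / 9 - 4 / 3 * t)) (Rmax (9 * x - 12 * t) (x - c))).
Definition pull_left (t c z : R) : R :=
  Rmax z (Rmin (Rmin (z + 2 * t) (9 * z + 12 * t)) (Rmin ((z + 12 * t) / 9) (z + c))).

(** The amount subtracted is [max 0 (min (t/2) ((y + 3/4 t) / 2) (10 (4/5 t - y)) c)]. The slopes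
    make both ramps reach [t/2] at the ends of [[t/4, 3/4 t]], the vertical extent of a tube centred
    at height [t/2]; likewise the ramps of [push_left] reach [2 t] at the ends of
    [[3/4 t, 5/4 t]]. *)
Definition push_down (t c y : R) : R :=
  Rmin y (Rmax (Rmax (y - t / 2) (y / 2 - 3 / 8 * t)) (Rmax (11 * y - 8 * t) (y - c))).
Definition pull_down (t c z : R) : R :=
  Rmax z (Rmin (Rmin (z + t / 2) (2 * z + 3 / 4 * t)) (Rmin ((z + 8 * t) / 11) (z + c))).

Ltac disj := solve [lra | left; disj | right; disj].

Ltac minmax := unfold Rmin, Rmax in *; repeat destruct Rle_dec; lra.

(** Each pair of hypotheses says that [a'] is the point at which the increasing function with value
    [a] at [x] takes the value [z]. Passing to inverses reverses comparisons, so minima and maxima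
    are exchanged. *)
Lemma minmax_inverse x z a b c d a' b' c' d' :
  z = Rmin x (Rmax (Rmax a b) (Rmax c d)) ->
  (a <= z -> x <= a') -> (z <= a -> a' <= x) -> (b <= z -> x <= b') -> (z <= b -> b' <= x) ->
  (c <= z -> x <= c') -> (z <= c -> c' <= x) -> (d <= z -> x <= d') -> (z <= d -> d' <= x) ->
  Rmax z (Rmin (Rmin a' b') (Rmin c' d')) = x.
Proof.
  intros E Ha Ha' Hb Hb' Hc Hc' Hd Hd'.
  pose proof (Rmin_l (Rmin a' b') (Rmin c' d')). pose proof (Rmin_r (Rmin a' b') (Rmin c' d')).
  pose proof (Rmin_l a' b'). pose proof (Rmin_r a' b').
  pose proof (Rmin_l c' d'). pose proof (Rmin_r c' d').
  pose proof (Rmax_l z (Rmin (Rmin a' b') (Rmin c' d'))).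
  apply Rle_antisym.
  - apply Rmax_lub; [rewrite E; apply Rmin_l|].
    assert (z <= Rmax (Rmax a b) (Rmax c d)) by (rewrite E; apply Rmin_r).
    assert (z <= a \/ z <= b \/ z <= c \/ z <= d) as [?|[?|[?|?]]].
    { revert H6. unfold Rmax. repeat destruct Rle_dec; tauto. }
    + specialize (Ha' H7). lra.
    + specialize (Hb' H7). lra.
    + specialize (Hc' H7). lra.
    + specialize (Hd' H7). lra.
  - destruct (Rle_or_lt x z); [lra|].
    assert (E' : z = Rmax (Rmax a b) (Rmax c d)) by (rewrite E in *; unfold Rmin in *; destruct Rle_dec; lra).
    pose proof (Rmax_l (Rmax a b) (Rmax c d)). pose proof (Rmax_r (Rmax a b) (Rmax c d)).
    pose proof (Rmax_l a b). pose proof (Rmax_r a b). pose proof (Rmax_l c d). pose proof (Rmax_r c d).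
    eapply Rle_trans; [|apply Rmax_r].
    repeat apply Rmin_glb; [apply Ha|apply Hb|apply Hc|apply Hd]; lra.
Qed.

Lemma maxmin_inverse x z a b c d a' b' c' d' :
  z = Rmax x (Rmin (Rmin a b) (Rmin c d)) ->
  (a <= z -> x <= a') -> (z <= a -> a' <= x) -> (b <= z -> x <= b') -> (z <= b -> b' <= x) ->
  (c <= z -> x <= c') -> (z <= c -> c' <= x) -> (d <= z -> x <= d') -> (z <= d -> d' <= x) ->
  Rmin z (Rmax (Rmax a' b') (Rmax c' d')) = x.
Proof.
  intros E Ha Ha' Hb Hb' Hc Hc' Hd Hd'.
  apply Ropp_eq_reg. rewrite Ropp_Rmin, !Ropp_Rmax.
  apply (minmax_inverse (- x) (- z) (- a) (- b) (- c) (- d)); try (intros; lra).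
  rewrite E, Ropp_Rmax, !Ropp_Rmin. reflexivity.
Qed.

Lemma push_pull_left t c x : pull_left t c (push_left t c x) = x.
Proof. eapply minmax_inverse; [reflexivity|..]; intros; unfold push_left, push_down in *; lra. Qed.

Lemma pull_push_left t c x : push_left t c (pull_left t c x) = x.
Proof. eapply maxmin_inverse; [reflexivity|..]; intros; unfold pull_left, pull_down in *; lra. Qed.

Lemma push_pull_down t c x : pull_down t c (push_down t c x) = x.
Proof. eapply minmax_inverse; [reflexivity|..]; intros; unfold push_left, push_down in *; lra. Qed.

Lemma pull_push_down t c x : push_down t c (pull_down t c x) = x.
Proof. eapply maxmin_inverse; [reflexivity|..]; intros; unfold pull_left, pull_down in *; lra. Qed.

(** For [t > 0] the cutoff is at least [2 t] exactly when [t/4 <= y <= 3/4 t], so the upper tube of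
    [X1] gets the full translation, and it is positive exactly when [0 < y < 4/5 t], so the lower
    tube is untouched. *)
Definition moveA (p : pt) : pt :=
  (push_left (tc p) (Rmin (8 * yc p) (40 * (4 / 5 * tc p - yc p))) (xc p), yc p, tc p).
Definition moveA' (p : pt) : pt :=
  (pull_left (tc p) (Rmin (8 * yc p) (40 * (4 / 5 * tc p - yc p))) (xc p), yc p, tc p).
(** The cutoff is at least [t/2] exactly on [-5/4 t <= x <= -3/4 t], the extent of a tube of the
    left lobe, and positive exactly on [-3/2 t < x < -t/2]. *)
Definition moveB (p : pt) : pt :=
  (xc p, push_down (tc p) (Rmin (2 * (- (tc p / 2) - xc p)) (2 * (xc p + 3 / 2 * tc p))) (yc p), tc p).
Definition moveB' (p : pt) : pt :=
  (xc p, pull_down (tc p) (Rmin (2 * (- (tc p / 2) - xc p)) (2 * (xc p + 3 / 2 * tc p))) (yc p), tc p).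
Definition half_turn (p : pt) : pt := (- xc p, - yc p, tc p).

(* In a section [t = 1]: [moveA] carries the upper disc of [X1] through the neck to
   [(-1, 1/2)], then [moveB] and its half-turn conjugate bring both discs to the x-axis. *)
Definition move (p : pt) : pt := half_turn (moveB (half_turn (moveB (moveA p)))).
Definition move' (p : pt) : pt := moveA' (moveB' (half_turn (moveB' (half_turn p)))).

Lemma half_turn_invol p : half_turn (half_turn p) = p.
Proof. destruct p as [[x y] t]. unfold half_turn, xc, yc, tc; simpl. now rewrite !Ropp_involutive. Qed.

Lemma moveAK p : moveA' (moveA p) = p.
Proof. rewrite (pt_eta p) at 2. unfold moveA', moveA, xc, yc, tc; simpl fst; simpl snd. now rewrite push_pull_left. Qed.
Lemma moveAK' p : moveA (moveA' p) = p.
Proof. rewrite (pt_eta p) at 2. unfold moveA', moveA, xc, yc, tc; simpl fst; simpl snd. now rewrite pull_push_left. Qed.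
Lemma moveBK p : moveB' (moveB p) = p.
Proof. rewrite (pt_eta p) at 2. unfold moveB', moveB, xc, yc, tc; simpl fst; simpl snd. now rewrite push_pull_down. Qed.
Lemma moveBK' p : moveB (moveB' p) = p.
Proof. rewrite (pt_eta p) at 2. unfold moveB', moveB, xc, yc, tc; simpl fst; simpl snd. now rewrite pull_push_down. Qed.

Lemma moveK p : move' (move p) = p.
Proof. unfold move, move'. now rewrite half_turn_invol, moveBK, half_turn_invol, moveBK, moveAK. Qed.
Lemma moveK' p : move (move' p) = p.
Proof. unfold move, move'. now rewrite moveAK', moveBK', half_turn_invol, moveBK', half_turn_invol. Qed.

(** A symmetric rectangle containing the supports of [moveA], of [moveB] and of the half-turn
    conjugate of [moveB]. *)
Definition box (p : pt) : Prop :=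
  - (3 / 2 * tc p) < xc p < 3 / 2 * tc p /\ - (4 / 5 * tc p) < yc p < 4 / 5 * tc p.

Lemma moveA_fix p : 0 < tc p ->
  xc p <= - (3 / 2 * tc p) \/ 3 / 2 * tc p <= xc p \/ yc p <= 0 \/ 4 / 5 * tc p <= yc p -> moveA p = p.
Proof.
  intros Ht H. rewrite (pt_eta p) at 2. unfold moveA. repeat f_equal. unfold push_left.
  destruct H as [H|[H|[H|H]]]; minmax.
Qed.

Lemma moveB_fix p : 0 < tc p ->
  xc p <= - (3 / 2 * tc p) \/ - (tc p / 2) <= xc p \/ yc p <= - (3 / 4 * tc p) \/ 4 / 5 * tc p <= yc p ->
  moveB p = p.
Proof.
  intros Ht H. rewrite (pt_eta p) at 2. unfold moveB. repeat f_equal. unfold push_down.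
  destruct H as [H|[H|[H|H]]]; minmax.
Qed.

Lemma not_box p : ~ box p ->
  xc p <= - (3 / 2 * tc p) \/ 3 / 2 * tc p <= xc p \/ yc p <= - (4 / 5 * tc p) \/ 4 / 5 * tc p <= yc p.
Proof.
  intros H. unfold box in H.
  destruct (Rle_or_lt (xc p) (- (3 / 2 * tc p))); [now left|].
  destruct (Rle_or_lt (3 / 2 * tc p) (xc p)); [now right; left|].
  destruct (Rle_or_lt (yc p) (- (4 / 5 * tc p))); [now right; right; left|].
  destruct (Rle_or_lt (4 / 5 * tc p) (yc p)); [now right; right; right|]. exfalso. apply H. lra.
Qed.

Lemma move_fix p : 0 < tc p -> ~ box p -> move p = p.
Proof.
  intros Ht H. apply not_box in H. unfold move.
  rewrite moveA_fix by (repeat destruct H as [H|H]; disj).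
  rewrite (moveB_fix p) by (repeat destruct H as [H|H]; disj).
  rewrite moveB_fix; [apply half_turn_invol| |]; unfold half_turn, xc, yc, tc in *; simpl fst; simpl snd.
  - exact Ht.
  - repeat destruct H as [H|H]; disj.
Qed.

Lemma moveA_tube p : tube 1 (1 / 2) p -> moveA p = shift (-2) 0 p.
Proof.
  intros H. destruct (tube_bounds _ _ _ H) as [Hx Hy]. destruct H as [_ Ht].
  unfold moveA, shift. replace (yc p + 0 * tc p) with (yc p) by ring. do 2 f_equal. unfold push_left. minmax.
Qed.

Lemma moveB_tube p : tube (-1) (1 / 2) p -> moveB p = shift 0 (- (1 / 2)) p.
Proof.
  intros H. destruct (tube_bounds _ _ _ H) as [Hx Hy]. destruct H as [_ Ht].
  unfold moveB, shift. replace (xc p + 0 * tc p) with (xc p) by ring. do 2 f_equal. unfold push_down. minmax.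
Qed.

Lemma tube_half_turn a b p : tube a b p -> tube (- a) (- b) (half_turn p).
Proof.
  unfold tube, half_turn, xc, yc, tc; simpl fst; simpl snd. intros [H Ht]. split; [|exact Ht].
  rewrite <- H. ring.
Qed.

Lemma move_upper p : 0 < tc p -> tube 1 (1 / 2) p -> tube (-1) 0 (move p).
Proof.
  intros Ht H. unfold move. rewrite moveA_tube by exact H.
  assert (H1 : tube (-1) (1 / 2) (shift (-2) 0 p)).
  { replace (-1) with (1 + -2) by ring. replace (1 / 2) with (1 / 2 + 0) by ring. now apply tube_shift. }
  rewrite (moveB_tube _ H1). set (q := shift (-2) 0 p) in *.
  assert (H2 : tube (-1) 0 (shift 0 (- (1 / 2)) q)).
  { replace (-1) with (-1 + 0) by ring. replace 0 with (1 / 2 + - (1 / 2)) at 2 by ring. now apply tube_shift. }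
  destruct (tube_bounds _ _ _ H2) as [Hx Hy].
  (* After the half turn this tube lies at [x >= 3/4 t], outside the strip where [moveB] acts. *)
  rewrite moveB_fix; [now rewrite half_turn_invol| |];
    unfold half_turn, q, shift, xc, yc, tc in *; simpl fst in *; simpl snd in *; disj.
Qed.

Lemma move_lower p : 0 < tc p -> tube 1 (- 1 / 2) p -> tube 1 0 (move p).
Proof.
  intros Ht H. unfold move. destruct (tube_bounds _ _ _ H) as [Hx Hy].
  rewrite moveA_fix by disj. rewrite (moveB_fix p) by disj.
  apply tube_half_turn in H. replace (- (- 1 / 2)) with (1 / 2) in H by field.
  replace (- (1)) with (-1) in H by ring. rewrite moveB_tube by exact H.
  apply (tube_shift _ _ 0 (- (1 / 2))), tube_half_turn in H.
  replace (- (-1 + 0)) with 1 in H by ring. now replace (- (1 / 2 + - (1 / 2))) with 0 in H by ring.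
Qed.

Lemma move'_right p : 0 < tc p -> tube 1 0 p -> tube 1 (- 1 / 2) (move' p).
Proof.
  intros Ht H. set (q := shift 0 (- (1 / 2)) p).
  assert (Hq : tube 1 (- 1 / 2) q).
  { replace 1 with (1 + 0) at 1 by ring. replace (- 1 / 2) with (0 + - (1 / 2)) by field. now apply tube_shift. }
  (* Exhibiting the preimage under [move] avoids evaluating the inverse formulas. *)
  replace p with (move q); [now rewrite moveK|].
  destruct (tube_bounds _ _ _ Hq) as [Hx Hy].
  assert (Htq : tc q = tc p) by reflexivity.
  unfold move. rewrite moveA_fix by disj. rewrite (moveB_fix q) by disj.
  rewrite moveB_tube.
  - destruct p as [[x y] t]. unfold q, half_turn, shift, xc, yc, tc; simpl fst; simpl snd. repeat f_equal; field.
  - apply tube_half_turn in Hq. replace (- (- 1 / 2)) with (1 / 2) in Hq by field.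
    now replace (- (1)) with (-1) in Hq by ring.
Qed.

Lemma move'_left p : 0 < tc p -> tube (-1) 0 p -> tube 1 (1 / 2) (move' p).
Proof.
  intros Ht H. set (q := shift 2 (1 / 2) p).
  assert (Hq : tube 1 (1 / 2) q).
  { replace 1 with (-1 + 2) at 1 by ring. replace (1 / 2) with (0 + 1 / 2) at 1 by ring. now apply tube_shift. }
  replace p with (move q); [now rewrite moveK|].
  assert (E : shift 0 (- (1 / 2)) (shift (-2) 0 q) = p).
  { destruct p as [[x y] t]. unfold q, shift, xc, yc, tc; simpl fst; simpl snd. repeat f_equal; field. }
  assert (H1 : tube (-1) (1 / 2) (shift (-2) 0 q)).
  { replace (-1) with (1 + -2) by ring. replace (1 / 2) with (1 / 2 + 0) by ring. now apply tube_shift. }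
  unfold move. rewrite moveA_tube by exact Hq. rewrite (moveB_tube _ H1). rewrite E.
  destruct (tube_bounds _ _ _ H) as [Hx Hy].
  rewrite moveB_fix; [now rewrite half_turn_invol| |];
    unfold half_turn, xc, yc, tc in *; simpl fst in *; simpl snd in *; disj.
Qed.

Definition upper (p : pt) : Prop := 0 < tc p.

Lemma pcont_half_turn A : pcont A half_turn.
Proof. apply pcont_pair; rcont_auto. Qed.
Lemma pcont_moveA A : pcont A moveA.
Proof. apply pcont_pair; unfold push_left; rcont_auto; intros; lra. Qed.
Lemma pcont_moveA' A : pcont A moveA'.
Proof. apply pcont_pair; unfold pull_left; rcont_auto; intros; lra. Qed.
Lemma pcont_moveB A : pcont A moveB.
Proof. apply pcont_pair; unfold push_down; rcont_auto; intros; lra. Qed.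
Lemma pcont_moveB' A : pcont A moveB'.
Proof. apply pcont_pair; unfold pull_down; rcont_auto; intros; lra. Qed.

Lemma pcont_move A : pcont A move.
Proof.
  unfold move.
  apply (pcont_comp A (fun _ => True) _ half_turn); [apply pcont_half_turn| |auto].
  apply (pcont_comp A (fun _ => True) _ moveB); [apply pcont_moveB| |auto].
  apply (pcont_comp A (fun _ => True) _ half_turn); [apply pcont_half_turn| |auto].
  apply (pcont_comp A (fun _ => True) _ moveB); [apply pcont_moveB| |auto].
  apply pcont_moveA.
Qed.

Lemma pcont_move' A : pcont A move'.
Proof.
  unfold move'.
  apply (pcont_comp A (fun _ => True) _ moveA'); [apply pcont_moveA'| |auto].
  apply (pcont_comp A (fun _ => True) _ moveB'); [apply pcont_moveB'| |auto].
  apply (pcont_comp A (fun _ => True) _ half_turn); [apply pcont_half_turn| |auto].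
  apply (pcont_comp A (fun _ => True) _ moveB'); [apply pcont_moveB'| |auto].
  apply pcont_half_turn.
Qed.

(* What is needed to transport a sectionwise map through the neck-opening stretch. *)
Record supported (F : pt -> pt) : Prop := {
  sup_t : forall p, tc (F p) = tc p;
  sup_fix : forall p, 0 < tc p -> ~ box p -> F p = p;
  sup_x : forall p, 0 < tc p -> box p -> Rabs (xc (F p)) <= 4 * tc p;
  sup_y : forall p, 0 < tc p -> box p -> Rabs (yc (F p)) <= 4 * tc p;
  sup_cont : pcont upper F }.

Lemma move_supported : supported move.
Proof.
  split.
  - reflexivity.
  - apply move_fix.
  - intros p Ht [Hx Hy]. unfold move, half_turn, moveB, moveA, xc, yc, tc in *; simpl fst in *; simpl snd in *.
    apply Rabs_le. unfold push_left. minmax.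
  - intros p Ht [Hx Hy].
    assert (E : forall c t y, 0 < t -> y - t / 2 <= push_down t c y <= y) by (intros; unfold push_down; minmax).
    set (q := moveB (moveA p)).
    assert (Hq : yc p - tc p / 2 <= yc q <= yc p) by now apply E.
    unfold move. fold q.
    assert (Hr : - yc q - tc p / 2 <= yc (moveB (half_turn q)) <= - yc q) by now apply E.
    change (yc (half_turn (moveB (half_turn q)))) with (- yc (moveB (half_turn q))).
    apply Rabs_le. lra.
  - apply pcont_move.
Qed.

Lemma move'_supported : supported move'.
Proof.
  split.
  - reflexivity.
  - intros p Ht Hb. rewrite <- (move_fix p Ht Hb) at 1. apply moveK.
  - intros p Ht [Hx Hy].
    assert (E : forall c t y, 0 < t -> y <= pull_left t c y <= y + 2 * t) by (intros; unfold pull_left; minmax).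
    assert (H : xc p <= xc (move' p) <= xc p + 2 * tc p).
    { unfold move'. set (q := moveB' (half_turn (moveB' (half_turn p)))).
      replace (xc p) with (xc q); [now apply E|].
      unfold q, moveB', half_turn, xc; simpl. ring. }
    apply Rabs_le. lra.
  - intros p Ht [Hx Hy].
    assert (E : forall c t y, 0 < t -> y <= pull_down t c y <= y + t / 2) by (intros; unfold pull_down; minmax).
    set (q := moveB' (half_turn p)).
    assert (Hq : - yc p <= yc q <= - yc p + tc p / 2) by now apply E.
    assert (Hr : - yc q <= yc (move' p) <= - yc q + tc p / 2) by now apply E.
    apply Rabs_le. lra.
  - apply pcont_move'.
Qed.

(** * Opening the neck by a vertical stretch *)

(* For [|x| <= t] this is the half-height of the region enclosed by the loop; freezing
   [|x|] at [t] keeps it positive everywhere on [t > 0]. *)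
Definition half_height (k : nat) (p : pt) : R :=
  sqrt (sqrt (4 * Rmin (Rabs (xc p)) (tc p) ^ 2 * tc p ^ 2 + tc p ^ k) - Rmin (Rabs (xc p)) (tc p) ^ 2).

(** Half-heights are raised to at least [3 t - 4 |x|]. This is at least [7/5 t], above the box, when
    [|x| <= 2/5 t], and at most 0 from [|x| = 3/4 t] on, where the tubes lie and must not be
    deformed. *)
Definition factor (k : nat) (p : pt) : R :=
  Rmax 1 ((3 * tc p - 4 * Rabs (xc p)) / half_height k p).

Definition stretch (k : nat) (p : pt) : pt := (xc p, yc p * factor k p, tc p).
Definition stretch' (k : nat) (p : pt) : pt := (xc p, yc p / factor k p, tc p).

(** With [a = min |x| t] one has [a^4 <= 4 a^2 t^2 < 4 a^2 t^2 + t^k]; the freezing gives the first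
    inequality. *)
Lemma half_height_rad k p : upper p ->
  0 <= 4 * Rmin (Rabs (xc p)) (tc p) ^ 2 * tc p ^ 2 + tc p ^ k /\
  0 < sqrt (4 * Rmin (Rabs (xc p)) (tc p) ^ 2 * tc p ^ 2 + tc p ^ k) - Rmin (Rabs (xc p)) (tc p) ^ 2.
Proof.
  unfold upper. intros Ht. set (a := Rmin (Rabs (xc p)) (tc p)).
  assert (Ha : 0 <= a <= tc p).
  { split; [apply Rmin_glb; [apply Rabs_pos|lra]|apply Rmin_r]. }
  pose proof (pow_lt _ k Ht) as Hk. pose proof (pow2_ge_0 a). pose proof (pow2_ge_0 (tc p)).
  split; [nra|].
  apply Rlt_0_minus. rewrite <- (sqrt_pow2 (a ^ 2)) at 1 by exact H.
  apply sqrt_lt_1_alt. assert (a ^ 2 <= tc p ^ 2) by nra. split; [nra|].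
  set (b := a ^ 2) in *. set (s := tc p ^ 2) in *. nra.
Qed.

Lemma half_height_pos k p : upper p -> 0 < half_height k p.
Proof. intros H. apply sqrt_lt_R0, (half_height_rad k p H). Qed.

Lemma factor_ge1 k p : 1 <= factor k p.
Proof. apply Rmax_l. Qed.

Lemma rcont_factor k : rcont upper (factor k).
Proof.
  unfold factor, half_height. rcont_auto; intros p H; destruct (half_height_rad k p H) as [H1 H2].
  - exact H1.
  - lra.
  - pose proof (half_height_pos k p H). unfold half_height in *. lra.
Qed.

Lemma pcont_stretch k : pcont upper (stretch k).
Proof. pose proof (rcont_factor k). apply pcont_pair; rcont_auto. Qed.

Lemma pcont_stretch' k : pcont upper (stretch' k).
Proof.
  pose proof (rcont_factor k). apply pcont_pair; rcont_auto.
  intros p _. pose proof (factor_ge1 k p). lra.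
Qed.

(** [factor] depends on [x] and [t] only, and both are preserved by the stretch. *)
Lemma stretchK k p : stretch' k (stretch k p) = p.
Proof.
  rewrite (pt_eta p) at 2. unfold stretch', stretch. change (xc (_, _, _)) with (xc p).
  pose proof (factor_ge1 k p).
  assert (E : factor k (xc p, yc p * factor k p, tc p) = factor k p) by reflexivity. rewrite E.
  change (yc (xc p, yc p * factor k p, tc p)) with (yc p * factor k p).
  change (tc (xc p, yc p * factor k p, tc p)) with (tc p).
  repeat f_equal. field. lra.
Qed.

Lemma stretchK' k p : stretch k (stretch' k p) = p.
Proof.
  rewrite (pt_eta p) at 2. unfold stretch', stretch. change (xc (_, _, _)) with (xc p).
  pose proof (factor_ge1 k p).
  assert (E : factor k (xc p, yc p / factor k p, tc p) = factor k p) by reflexivity. rewrite E.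
  change (yc (xc p, yc p / factor k p, tc p)) with (yc p / factor k p).
  change (tc (xc p, yc p / factor k p, tc p)) with (tc p).
  repeat f_equal. field. lra.
Qed.

(** * Conjugation of a supported map by the stretch *)

Definition conjugate (k : nat) (F : pt -> pt) (p : pt) : pt :=
  if Rlt_dec 0 (tc p) then stretch' k (F (stretch k p)) else p.

Lemma conjugateK k F F' p : supported F -> (forall p, F' (F p) = p) ->
  conjugate k F' (conjugate k F p) = p.
Proof.
  intros HF E. unfold conjugate. destruct (Rlt_dec 0 (tc p)) as [H|H].
  - change (tc (stretch' k (F (stretch k p)))) with (tc (F (stretch k p))).
    rewrite (sup_t F HF). change (tc (stretch k p)) with (tc p).
    destruct (Rlt_dec 0 (tc p)); [|contradiction]. now rewrite stretchK', E, stretchK.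
  - destruct (Rlt_dec 0 (tc p)); [contradiction|reflexivity].
Qed.

(** This replaces continuity of the stretch at [t <= 0]. Since [factor >= 1], neither undoing the
    stretch nor passing from [stretch k p] back to [p] increases [|y|]; 11 rounds up
    [3/2 + 4 + 4/5 + 4]. *)
Lemma conjugate_near k F p : supported F -> d1 (conjugate k F p) p <= 11 * Rmax 0 (tc p).
Proof.
  intros HF. unfold conjugate. destruct (Rlt_dec 0 (tc p)) as [H|H].
  2: { rewrite d1_refl. pose proof (Rmax_l 0 (tc p)). lra. }
  rewrite Rmax_right by lra.
  destruct (classic (box (stretch k p))) as [Hb|Hb].
  2: { rewrite (sup_fix F HF) by assumption. rewrite stretchK, d1_refl. lra. }
  pose proof (sup_x F HF (stretch k p) H Hb) as Bx. pose proof (sup_y F HF (stretch k p) H Hb) as By.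
  pose proof (sup_t F HF (stretch k p)) as Bt.
  set (q := F (stretch k p)) in *. change (tc (stretch k p)) with (tc p) in *.
  destruct Hb as [Hx Hy]. change (tc (stretch k p)) with (tc p) in *.
  change (xc (stretch k p)) with (xc p) in *. change (yc (stretch k p)) with (yc p * factor k p) in Hy.
  assert (Hyp : Rabs (yc p) <= 4 / 5 * tc p).
  { assert (Rabs (yc p * factor k p) <= 4 / 5 * tc p) by (apply Rabs_le; lra).
    rewrite Rabs_mult, (Rabs_right (factor k p)) in H0 by (pose proof (factor_ge1 k p); lra).
    pose proof (factor_ge1 k p). pose proof (Rabs_pos (yc p)). nra. }
  assert (Hyq : Rabs (yc (stretch' k q)) <= 4 * tc p).
  { change (yc (stretch' k q)) with (yc q / factor k q). pose proof (factor_ge1 k q).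
    unfold Rdiv. rewrite Rabs_mult, Rabs_inv, (Rabs_right (factor k q)) by lra.
    apply Rle_trans with (Rabs (yc q) * 1); [|lra]. apply Rmult_le_compat_l; [apply Rabs_pos|].
    rewrite <- Rinv_1. apply Rinv_le_contravar; lra. }
  assert (Hxp : Rabs (xc p) <= 3 / 2 * tc p) by (apply Rabs_le; lra).
  unfold d1. change (tc (stretch' k q)) with (tc q). change (xc (stretch' k q)) with (xc q).
  rewrite Bt, Rminus_diag, Rabs_R0.
  pose proof (Rabs_triang (xc q) (- xc p)) as T1. pose proof (Rabs_triang (yc (stretch' k q)) (- yc p)) as T2.
  rewrite Rabs_Ropp in T1, T2. unfold Rminus. lra.
Qed.

Lemma conjugate_cont k F : supported F -> pcont (fun _ => True) (conjugate k F).
Proof.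
  intros HF. rewrite pcont_d1. intros p _ e He.
  destruct (Rlt_dec 0 (tc p)) as [H|H].
  - assert (C : pcont upper (fun p => stretch' k (F (stretch k p)))).
    { apply (pcont_comp upper upper (fun p => F (stretch k p)) (stretch' k)); [apply pcont_stretch'| |].
      - apply (pcont_comp upper upper (stretch k) F); [apply HF|apply pcont_stretch|auto].
      - intros q Hq. unfold upper. now rewrite (sup_t F HF). }
    rewrite pcont_d1 in C. destruct (C p H e He) as [d [Hd Ed]].
    exists (Rmin d (tc p)). split; [now apply Rmin_glb_lt|]. intros q _ Hq.
    pose proof (Rmin_l d (tc p)). pose proof (Rmin_r d (tc p)).
    assert (Hq0 : 0 < tc q).
    { destruct (d1_coord p q) as [_ [_ E]].
      assert (tc p - tc q < tc p); [|lra]. eapply Rle_lt_trans; [apply Rle_abs|]. lra. }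
    unfold conjugate. destruct (Rlt_dec 0 (tc p)); [|contradiction].
    destruct (Rlt_dec 0 (tc q)); [|contradiction]. apply Ed; [exact Hq0|lra].
  - exists (e / 12). split; [lra|]. intros q _ Hq.
    assert (E : conjugate k F p = p) by (unfold conjugate; destruct Rlt_dec; [contradiction|reflexivity]).
    rewrite E. pose proof (conjugate_near k F q HF) as N. rewrite d1_sym in N.
    pose proof (d1_triangle p q (conjugate k F q)).
    assert (Rmax 0 (tc q) <= d1 p q).
    { apply Rmax_lub; [apply d1_pos|]. destruct (d1_coord p q) as [_ [_ E']]. rewrite Rabs_minus_sym in E'.
      pose proof (Rle_abs (tc q - tc p)). lra. }
    lra.
Qed.

(** For [|x| >= 2/5 t] a point of the box is strictly inside one of the discs of radius [t] about
    [(t, 0)] and [(-t, 0)], because [(3/5)^2 + (4/5)^2 = 1], while the loop avoids both. For smaller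
    [|x|], [half_height] equals [|y|] on the loop and the stretch lifts the point above the box. *)
Lemma loop_stretch_not_box k p : 0 < tc p -> loop k p -> ~ box (stretch k p).
Proof.
  intros Ht HL [Hx Hy]. change (tc (stretch k p)) with (tc p) in *.
  change (xc (stretch k p)) with (xc p) in *. change (yc (stretch k p)) with (yc p * factor k p) in Hy.
  pose proof (factor_ge1 k p) as Hm.
  assert (Hy' : Rabs (yc p) * factor k p < 4 / 5 * tc p).
  { rewrite <- (Rabs_right (factor k p)), <- Rabs_mult by lra. apply Rabs_def1; lra. }
  pose proof (Rabs_pos (yc p)) as Hy0.
  assert (Hy1 : Rabs (yc p) < 4 / 5 * tc p) by nra.
  assert (Hy2 : yc p ^ 2 < (4 / 5 * tc p) ^ 2) by (rewrite <- (pow2_abs (yc p)); nra).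
  destruct (Rle_or_lt (2 / 5 * tc p) (Rabs (xc p))) as [Hc|Hc].
  - destruct (loop_outside k p HL) as [H1 H2]. unfold Rabs in Hc. destruct Rcase_abs; nra.
  - assert (Hh : half_height k p = Rabs (yc p)).
    { unfold half_height. rewrite Rmin_left by lra. rewrite pow2_abs.
      destruct HL as [HL _]. unfold quartic in HL.
      replace (4 * xc p ^ 2 * tc p ^ 2 + tc p ^ k) with ((xc p ^ 2 + yc p ^ 2) ^ 2) by lra.
      rewrite sqrt_pow2 by nra.
      replace (xc p ^ 2 + yc p ^ 2 - xc p ^ 2) with (yc p ^ 2) by ring.
      rewrite <- pow2_abs. now apply sqrt_pow2. }
    pose proof (half_height_pos k p Ht) as Hp. rewrite Hh in Hp.
    assert (Hf : (3 * tc p - 4 * Rabs (xc p)) / Rabs (yc p) <= factor k p).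
    { unfold factor. rewrite Hh. apply Rmax_r. }
    apply (Rmult_le_compat_l (Rabs (yc p))) in Hf; [|lra].
    replace (Rabs (yc p) * ((3 * tc p - 4 * Rabs (xc p)) / Rabs (yc p)))
      with (3 * tc p - 4 * Rabs (xc p)) in Hf by (field; lra).
    lra.
Qed.

Lemma factor_far k p : 0 < tc p -> 3 / 4 * tc p <= Rabs (xc p) -> factor k p = 1.
Proof.
  intros Ht H. unfold factor. apply Rmax_left. pose proof (half_height_pos k p Ht).
  apply Rle_trans with 0; [|lra]. unfold Rdiv.
  pose proof (Rinv_0_lt_compat _ H0). nra.
Qed.

Lemma tube_far a b p : tube a b p -> a = 1 \/ a = -1 -> 3 / 4 * tc p <= Rabs (xc p).
Proof.
  intros H Ha. destruct (tube_bounds _ _ _ H) as [Hx _]. destruct H as [_ Ht].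
  destruct Ha; subst a; unfold Rabs; destruct Rcase_abs; lra.
Qed.

Lemma stretch_tube k a b p : 0 < tc p -> tube a b p -> a = 1 \/ a = -1 -> stretch k p = p /\ stretch' k p = p.
Proof.
  intros Ht H Ha. pose proof (factor_far k p Ht (tube_far a b p H Ha)) as E.
  unfold stretch, stretch'. rewrite E. rewrite (pt_eta p) at 4 8. split; repeat f_equal; field.
Qed.

Lemma conjugate_loop k F p : supported F -> loop k p -> conjugate k F p = p.
Proof.
  intros HF H. unfold conjugate. destruct Rlt_dec; [|reflexivity].
  rewrite (sup_fix F HF); [apply stretchK|assumption|now apply loop_stretch_not_box].
Qed.

Lemma conjugate_tube k F a b c d p : supported F -> a = 1 \/ a = -1 -> c = 1 \/ c = -1 ->
  0 < tc p -> tube a b p -> tube c d (F p) -> tube c d (conjugate k F p).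
Proof.
  intros HF Ha Hc Ht H H'. unfold conjugate. destruct Rlt_dec; [|contradiction].
  rewrite (proj1 (stretch_tube k a b p Ht H Ha)).
  rewrite (proj2 (stretch_tube k c d (F p) ltac:(now rewrite (sup_t F HF)) H' Hc)). exact H'.
Qed.

Lemma pieces_pos k a b p : (0 < k)%nat -> tube a b p -> loop k p \/ 0 < tc p.
Proof.
  intros hk H. destruct (Req_dec (tc p) 0) as [Z|Z].
  - left. rewrite (tube_0 a b p H Z). now apply loop_origin.
  - right. destruct H. lra.
Qed.

Lemma topo_equiv k : (0 < k)%nat -> ambient_topo_equiv (X1 k) (X2 k).
Proof.
  intros hk.
  pose proof move_supported as S. pose proof move'_supported as S'.
  assert (HX : forall p, X1 k p -> X2 k (conjugate k move p)).
  { intros p. rewrite X1_pieces, X2_pieces. intros [H|[H|H]].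
    - left. now rewrite conjugate_loop.
    - destruct (pieces_pos k _ _ p hk H) as [HL|Ht]; [left; now rewrite conjugate_loop|].
      right; right. apply (conjugate_tube k move 1 (1 / 2)); auto; now apply move_upper.
    - destruct (pieces_pos k _ _ p hk H) as [HL|Ht]; [left; now rewrite conjugate_loop|].
      right; left. apply (conjugate_tube k move 1 (- 1 / 2)); auto; now apply move_lower. }
  assert (GX : forall p, X2 k p -> X1 k (conjugate k move' p)).
  { intros p. rewrite X1_pieces, X2_pieces. intros [H|[H|H]].
    - left. now rewrite conjugate_loop.
    - destruct (pieces_pos k _ _ p hk H) as [HL|Ht]; [left; now rewrite conjugate_loop|].
      right; right. apply (conjugate_tube k move' 1 0); auto; now apply move'_right.
    - destruct (pieces_pos k _ _ p hk H) as [HL|Ht]; [left; now rewrite conjugate_loop|].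
      right; left. apply (conjugate_tube k move' (-1) 0); auto; now apply move'_left. }
  assert (E : forall p, conjugate k move' (conjugate k move p) = p)
    by (intros; apply conjugateK; [exact S|apply moveK]).
  assert (E' : forall p, conjugate k move (conjugate k move' p) = p)
    by (intros; apply conjugateK; [exact S'|apply moveK']).
  exists (fun _ => True), (fun _ => True), (conjugate k move), (conjugate k move').
  unfold ambient_homeo_germ.
  split; [apply is_open_full|]. split; [apply is_open_full|].
  split; [exact I|]. split; [exact I|].
  split; [apply conjugate_loop; [exact S|now apply loop_origin]|].
  split; [auto|]. split; [auto|]. split; [auto|]. split; [auto|].
  split; [now apply pcont_continuous_on, conjugate_cont|].
  split; [now apply pcont_continuous_on, conjugate_cont|].
  exists 1. split; [lra|]. intros q _. split.
  - intros Hq. exists (conjugate k move' q). auto.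
  - intros [p [_ [Hp <-]]]. auto.
Qed.

(** * Connectedness of the pieces, as constancy of signs *)

Lemma segment_same_sign (A : pt -> Prop) (f : pt -> R) (p q : pt) :
  rcont A f -> (forall z, A z -> f z <> 0) ->
  (forall s, 0 <= s <= 1 -> A (lerp p q s)) -> 0 < f p * f q.
Proof.
  intros Hf Hn HA.
  assert (Ap : A p) by (rewrite <- (lerp0 p q); apply HA; lra).
  specialize (Hn p Ap) as Np. destruct (Rlt_or_le 0 (f p)) as [H|H].
  - apply Rmult_lt_0_compat; [exact H|]. now apply (segment_sign A f p q).
  - rewrite <- Rmult_opp_opp. apply Rmult_lt_0_compat; [lra|].
    apply (segment_sign A (fun z => - f z) p q); [rcont_auto| |exact HA|lra].
    intros z Hz. specialize (Hn z Hz). lra.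
Qed.

Lemma same_sign_trans a b c : 0 < a * b -> 0 < b * c -> 0 < a * c.
Proof.
  intros H1 H2. assert (0 < a * c * b ^ 2) by nra. pose proof (pow2_ge_0 b). nra.
Qed.

Definition punctured (a b t : R) (p : pt) : Prop :=
  tc p = t /\ 0 < (xc p - a) ^ 2 + (yc p - b) ^ 2.

(* Either perpendicular of [p] is reached from [p] by a segment avoiding the centre, and one
   of the two makes a non-obtuse angle with [q]. *)
Lemma punctured_same_sign a b t f p q : rcont (punctured a b t) f ->
  (forall z, punctured a b t z -> f z <> 0) -> punctured a b t p -> punctured a b t q -> 0 < f p * f q.
Proof.
  intros Hf Hn [Tp Pp] [Tq Pq].
  (* When the angle is not obtuse, the squared norm along the segment is a sum of nonnegative terms,
     and the one with the larger weight is positive. *)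
  assert (K : forall u v u' v', 0 < u ^ 2 + v ^ 2 -> 0 < u' ^ 2 + v' ^ 2 -> 0 <= u * u' + v * v' ->
    0 < f (a + u, b + v, t) * f (a + u', b + v', t)).
  { intros u v u' v' H H' Hd. apply (segment_same_sign _ f _ _ Hf Hn).
    intros s Hs. unfold punctured, lerp, xc, yc, tc; simpl fst; simpl snd. split; [ring|].
    replace (((1 - s) * (a + u) + s * (a + u') - a) ^ 2 + ((1 - s) * (b + v) + s * (b + v') - b) ^ 2)
      with ((1 - s) ^ 2 * (u ^ 2 + v ^ 2) + 2 * (s * (1 - s)) * (u * u' + v * v') + s ^ 2 * (u' ^ 2 + v' ^ 2)) by ring.
    assert (0 <= s * (1 - s)) by nra.
    assert (0 <= 2 * (s * (1 - s)) * (u * u' + v * v')) by (apply Rmult_le_pos; lra).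
    destruct (Rle_or_lt s (1 / 2)).
    - assert (0 < (1 - s) ^ 2) by nra. pose proof (pow2_ge_0 s). nra.
    - assert (0 < s ^ 2) by nra. pose proof (pow2_ge_0 (1 - s)). nra. }
  set (u := xc p - a) in *. set (v := yc p - b) in *.
  set (u' := xc q - a) in *. set (v' := yc q - b) in *.
  assert (Ep : p = (a + u, b + v, t)) by (rewrite (pt_eta p), Tp; unfold u, v; repeat f_equal; ring).
  assert (Eq : q = (a + u', b + v', t)) by (rewrite (pt_eta q), Tq; unfold u', v'; repeat f_equal; ring).
  rewrite Ep, Eq.
  destruct (Rle_or_lt 0 (- v * u' + u * v')) as [Hs|Hs].
  - apply same_sign_trans with (f (a + - v, b + u, t)); apply K; try lra; nra.
  - apply same_sign_trans with (f (a + v, b + - u, t)); apply K; try lra; nra.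
Qed.

(** * Radial projections and the connectedness of loop sections and tubes *)

Definition norm1 (p : pt) : R := d1 p origin.

Lemma norm1_coord p : Rabs (xc p) <= norm1 p /\ Rabs (yc p) <= norm1 p /\ Rabs (tc p) <= norm1 p.
Proof.
  destruct (d1_coord p origin) as [? [? ?]]. unfold origin, xc, yc, tc, norm1 in *; simpl fst in *; simpl snd in *.
  rewrite Rminus_0_r in *. auto.
Qed.

Lemma norm1_def p : norm1 p = Rabs (xc p) + Rabs (yc p) + Rabs (tc p).
Proof.
  unfold norm1, d1, origin, xc, yc, tc; simpl fst; simpl snd. now rewrite !Rminus_0_r.
Qed.

Lemma norm1_origin : norm1 origin = 0.
Proof. apply d1_refl. Qed.

Lemma norm1_scale l p : 0 <= l -> norm1 (l * xc p, l * yc p, l * tc p) = l * norm1 p.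
Proof.
  intros Hl. rewrite !norm1_def. unfold xc, yc, tc; cbn [fst snd].
  rewrite !Rabs_mult, (Rabs_right l) by lra. ring.
Qed.

(** Radial projection from the t-axis: [(r x, r y, t)] is on the loop when
    [n^2 r^4 - 4 x^2 t^2 r^2 = t^k], a quadratic equation in [r^2] whose larger root is taken. *)
Definition loop_proj (k : nat) (p : pt) : pt :=
  let n := xc p ^ 2 + yc p ^ 2 in
  let r := sqrt (2 * xc p ^ 2 * tc p ^ 2 + sqrt (4 * xc p ^ 4 * tc p ^ 4 + n ^ 2 * tc p ^ k)) / n in
  (xc p * r, yc p * r, tc p).

Lemma loop_proj_loop k p : 0 <= tc p -> 0 < xc p ^ 2 + yc p ^ 2 -> loop k (loop_proj k p).
Proof.
  intros Ht Hn. unfold loop, loop_proj.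
  set (n := xc p ^ 2 + yc p ^ 2) in *.
  set (D := 4 * xc p ^ 4 * tc p ^ 4 + n ^ 2 * tc p ^ k).
  assert (Hk : 0 <= tc p ^ k) by now apply pow_le.
  assert (Hx : 0 <= xc p ^ 4) by (replace (xc p ^ 4) with ((xc p ^ 2) ^ 2) by ring; apply pow2_ge_0).
  assert (HT : 0 <= tc p ^ 4) by now apply pow_le.
  assert (HD : 0 <= D) by (unfold D; pose proof (pow2_ge_0 n); nra).
  set (E := 2 * xc p ^ 2 * tc p ^ 2 + sqrt D).
  assert (HE : 0 <= E).
  { unfold E. pose proof (sqrt_pos D). pose proof (pow2_ge_0 (xc p)). pose proof (pow2_ge_0 (tc p)). nra. }
  split; [|exact Ht]. unfold quartic. change (tc (xc p * (sqrt E / n), yc p * (sqrt E / n), tc p)) with (tc p).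
  change (xc (xc p * (sqrt E / n), yc p * (sqrt E / n), tc p)) with (xc p * (sqrt E / n)).
  change (yc (xc p * (sqrt E / n), yc p * (sqrt E / n), tc p)) with (yc p * (sqrt E / n)).
  set (r := sqrt E / n).
  assert (Hr : r ^ 2 = E / n ^ 2) by (rewrite <- (pow2_sqrt E HE); unfold r; field; lra).
  replace (((xc p * r) ^ 2 - 2 * (xc p * r) * tc p + (yc p * r) ^ 2) *
    ((xc p * r) ^ 2 + 2 * (xc p * r) * tc p + (yc p * r) ^ 2))
    with ((r ^ 2) ^ 2 * n ^ 2 - 4 * xc p ^ 2 * tc p ^ 2 * r ^ 2) by (unfold n; ring).
  rewrite Hr.
  replace ((E / n ^ 2) ^ 2 * n ^ 2 - 4 * xc p ^ 2 * tc p ^ 2 * (E / n ^ 2) - tc p ^ k)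
    with ((E ^ 2 - 4 * xc p ^ 2 * tc p ^ 2 * E - n ^ 2 * tc p ^ k) / n ^ 2) by (field; lra).
  replace (E ^ 2 - 4 * xc p ^ 2 * tc p ^ 2 * E - n ^ 2 * tc p ^ k) with 0; [unfold Rdiv; ring|].
  unfold E.
  replace ((2 * xc p ^ 2 * tc p ^ 2 + sqrt D) ^ 2 - 4 * xc p ^ 2 * tc p ^ 2 * (2 * xc p ^ 2 * tc p ^ 2 + sqrt D) - n ^ 2 * tc p ^ k)
    with (sqrt D ^ 2 - 4 * xc p ^ 4 * tc p ^ 4 - n ^ 2 * tc p ^ k) by ring.
  rewrite pow2_sqrt by exact HD. unfold D. ring.
Qed.

Lemma loop_proj_id k p : loop k p -> 0 < xc p ^ 2 + yc p ^ 2 -> loop_proj k p = p.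
Proof.
  intros [H Ht] Hn. unfold loop_proj. transitivity (xc p, yc p, tc p); [|symmetry; apply pt_eta].
  set (n := xc p ^ 2 + yc p ^ 2) in *.
  assert (Hk : tc p ^ k = n ^ 2 - 4 * xc p ^ 2 * tc p ^ 2).
  { unfold quartic in H. unfold n. replace (tc p ^ k) with ((xc p ^ 2 - 2 * xc p * tc p + yc p ^ 2) *
      (xc p ^ 2 + 2 * xc p * tc p + yc p ^ 2)) by lra. ring. }
  pose proof (pow_le _ k Ht) as Pk. rewrite Hk in Pk.
  pose proof (pow2_ge_0 (xc p * tc p)).
  rewrite Hk. replace (4 * xc p ^ 4 * tc p ^ 4 + n ^ 2 * (n ^ 2 - 4 * xc p ^ 2 * tc p ^ 2))
    with ((n ^ 2 - 2 * xc p ^ 2 * tc p ^ 2) ^ 2) by ring.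
  rewrite sqrt_pow2 by nra.
  replace (2 * xc p ^ 2 * tc p ^ 2 + (n ^ 2 - 2 * xc p ^ 2 * tc p ^ 2)) with (n ^ 2) by ring.
  rewrite sqrt_pow2 by lra. repeat f_equal; field; lra.
Qed.

Lemma loop_off_axis k p : loop k p -> 0 < tc p -> 0 < xc p ^ 2 + yc p ^ 2.
Proof.
  intros [H _] Ht. pose proof (pow_lt _ k Ht). pose proof (pow2_ge_0 (xc p)). pose proof (pow2_ge_0 (yc p)).
  destruct (Req_dec (xc p ^ 2 + yc p ^ 2) 0) as [E|E]; [|lra].
  assert (Ex : xc p = 0) by nra. assert (Ey : yc p = 0) by nra.
  unfold quartic in H. rewrite Ex, Ey in H. nra.
Qed.

(** The section is a retract of the punctured plane by [loop_proj], so the sign is followed on the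
    plane for the composed function. *)
Lemma loop_same_sign k t f p q : 0 < t -> rcont (fun z => loop k z /\ tc z = t) f ->
  (forall z, loop k z /\ tc z = t -> f z <> 0) ->
  loop k p -> tc p = t -> loop k q -> tc q = t -> 0 < f p * f q.
Proof.
  intros Ht Hf Hn Lp Tp Lq Tq.
  assert (P : forall z, punctured 0 0 t z -> 0 < xc z ^ 2 + yc z ^ 2).
  { intros z [_ H]. now rewrite !Rminus_0_r in H. }
  assert (P' : forall z, loop k z -> tc z = t -> punctured 0 0 t z).
  { intros z L T. split; [exact T|]. rewrite !Rminus_0_r. apply (loop_off_axis k); [exact L|lra]. }
  assert (M : forall z, punctured 0 0 t z -> loop k (loop_proj k z) /\ tc (loop_proj k z) = t).
  { intros z Hz. destruct Hz as [T Z]. split; [|exact T].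
    apply loop_proj_loop; [lra|]. now rewrite !Rminus_0_r in Z. }
  rewrite <- (loop_proj_id k p), <- (loop_proj_id k q); auto.
  apply (punctured_same_sign 0 0 t (fun z => f (loop_proj k z))); auto.
  apply (rcont_comp _ (fun z => loop k z /\ tc z = t)); [exact Hf| |exact M].
  apply pcont_pair; rcont_auto; intros z Hz; try (specialize (P z Hz); lra);
    destruct Hz as [T Z]; rewrite T; pose proof (pow_lt t k Ht); pose proof (pow_lt t 2 Ht);
    pose proof (pow_lt t 4 Ht); pose proof (pow2_ge_0 (xc z ^ 2 + yc z ^ 2)); pose proof (pow2_ge_0 (xc z));
    assert (0 <= xc z ^ 4) by (replace (xc z ^ 4) with ((xc z ^ 2) ^ 2) by ring; apply pow2_ge_0).
  all: match goal with |- 0 <= _ + sqrt ?D => pose proof (sqrt_pos D) | _ => idtac end; nra.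
Qed.

Definition tube_proj (a b : R) (p : pt) : pt :=
  let u := xc p - a * tc p in let v := yc p - b * tc p in
  let r := tc p / 4 / sqrt (u ^ 2 + v ^ 2) in
  (a * tc p + u * r, b * tc p + v * r, tc p).

Lemma tube_proj_tube a b p : 0 <= tc p -> 0 < (xc p - a * tc p) ^ 2 + (yc p - b * tc p) ^ 2 ->
  tube a b (tube_proj a b p).
Proof.
  intros Ht H. destruct p as [[x y] t]. unfold tube, tube_proj, xc, yc, tc in *.
  cbn [fst snd] in *. split; [|exact Ht].
  set (u := x - a * t) in *. set (v := y - b * t) in *. set (s := sqrt (u ^ 2 + v ^ 2)).
  assert (Hs : 0 < s) by now apply sqrt_lt_R0.
  assert (Es : s ^ 2 = u ^ 2 + v ^ 2) by (apply pow2_sqrt; lra).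
  replace ((a * t + u * (t / 4 / s) - a * t) ^ 2 + (b * t + v * (t / 4 / s) - b * t) ^ 2)
    with ((u ^ 2 + v ^ 2) * (t ^ 2 / 16) / s ^ 2) by (field; lra).
  rewrite <- Es. field. lra.
Qed.

Lemma tube_radius a b p : tube a b p ->
  sqrt ((xc p - a * tc p) ^ 2 + (yc p - b * tc p) ^ 2) = tc p / 4.
Proof.
  intros [H Ht]. rewrite H. replace (tc p ^ 2 / 16) with ((tc p / 4) ^ 2) by field.
  apply sqrt_pow2. lra.
Qed.

Lemma tube_proj_id a b p : tube a b p -> 0 < tc p -> tube_proj a b p = p.
Proof.
  intros H Ht. unfold tube_proj. rewrite (tube_radius _ _ _ H). transitivity (xc p, yc p, tc p); [|symmetry; apply pt_eta].
  repeat f_equal; field; lra.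
Qed.

Lemma pcont_tube_proj a b A : (forall z, A z -> 0 < (xc z - a * tc z) ^ 2 + (yc z - b * tc z) ^ 2) ->
  pcont A (tube_proj a b).
Proof.
  intros H. apply pcont_pair; rcont_auto; intros z Hz; specialize (H z Hz); try lra.
  all: pose proof (sqrt_lt_R0 _ H); lra.
Qed.

Lemma tube_level_same_sign a b t f p q : 0 < t -> rcont (fun z => tube a b z /\ tc z = t) f ->
  (forall z, tube a b z /\ tc z = t -> f z <> 0) ->
  tube a b p -> tc p = t -> tube a b q -> tc q = t -> 0 < f p * f q.
Proof.
  intros Ht Hf Hn Lp Tp Lq Tq.
  assert (P : forall z, punctured (a * t) (b * t) t z -> 0 < (xc z - a * tc z) ^ 2 + (yc z - b * tc z) ^ 2).
  { intros z [-> H]. exact H. }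
  assert (P' : forall z, tube a b z -> tc z = t -> punctured (a * t) (b * t) t z).
  { intros z [L _] T. split; [exact T|]. rewrite T in L. rewrite L. nra. }
  assert (M : forall z, punctured (a * t) (b * t) t z -> tube a b (tube_proj a b z) /\ tc (tube_proj a b z) = t).
  { intros z Hz. split; [|apply Hz]. apply tube_proj_tube; [destruct Hz; lra|now apply P]. }
  rewrite <- (tube_proj_id a b p), <- (tube_proj_id a b q); auto; try lra.
  apply (punctured_same_sign (a * t) (b * t) t (fun z => f (tube_proj a b z))); auto.
  apply (rcont_comp _ (fun z => tube a b z /\ tc z = t)); [exact Hf| |exact M].
  now apply pcont_tube_proj.
Qed.

Lemma tube_norm1 a b p : -1 <= a <= 1 -> - (1 / 2) <= b <= 1 / 2 -> tube a b p -> norm1 p <= 3 * tc p.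
Proof.
  intros Ha Hb H. destruct (tube_bounds _ _ _ H) as [Hx Hy]. destruct H as [_ Ht].
  rewrite norm1_def. assert (Rabs (xc p) <= 5 / 4 * tc p) by (apply Rabs_le; nra).
  assert (Rabs (yc p) <= 3 / 4 * tc p) by (apply Rabs_le; nra).
  rewrite (Rabs_right (tc p)) by lra. lra.
Qed.

(** The path follows the generator of the cone from [p] to the height of [q], then turns in that
    section. As [norm1 <= 3 t] on a tube, [3 * tc q < d] keeps the whole section in the ball. *)
Lemma tube_same_sign a b d f p q : -1 <= a <= 1 -> - (1 / 2) <= b <= 1 / 2 ->
  rcont (fun z => tube a b z /\ 0 < tc z /\ norm1 z < d) f ->
  (forall z, tube a b z /\ 0 < tc z /\ norm1 z < d -> f z <> 0) ->
  tube a b p -> 0 < tc p -> norm1 p < d -> tube a b q -> 0 < tc q -> 3 * tc q < d -> 0 < f p * f q.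
Proof.
  intros Ha Hb Hf Hn Lp Tp Np Lq Tq Nq.
  set (c := tc q / tc p). assert (Hc : 0 < c) by now apply Rdiv_lt_0_compat.
  assert (Ec : c * tc p = tc q) by (unfold c; field; lra). clearbody c.
  assert (S : forall l, 0 <= l -> tube a b (l * xc p, l * yc p, l * tc p)).
  { intros l Hl. destruct Lp as [L _]. unfold tube, xc, yc, tc in *; simpl fst; simpl snd.
    split; [|nra]. replace ((l * snd p) ^ 2 / 16) with (l ^ 2 * (snd p ^ 2 / 16)) by field. rewrite <- L. ring. }
  apply same_sign_trans with (f (c * xc p, c * yc p, c * tc p)).
  - apply (segment_same_sign _ f _ _ Hf Hn). intros s Hs.
    set (l := (1 - s) + s * c). assert (Hl : 0 < l) by (unfold l; nra).
    replace (lerp p (c * xc p, c * yc p, c * tc p) s) with (l * xc p, l * yc p, l * tc p).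
    2: { unfold lerp, l, xc, yc, tc; cbn [fst snd]. apply f_equal2; [apply f_equal2|]; ring. }
    split; [apply S; lra|]. split; [unfold tc in *; simpl; nra|].
    rewrite norm1_scale by lra.
    pose proof (tube_norm1 a b p Ha Hb Lp).
    assert (c * norm1 p <= c * (3 * tc p)) by (apply Rmult_le_compat_l; lra).
    assert (c * norm1 p <= 3 * tc q) by lra.
    unfold l. replace ((1 - s + s * c) * norm1 p) with ((1 - s) * norm1 p + s * (c * norm1 p)) by ring.
    destruct (Req_dec s 1) as [->|]; [lra|]. nra.
  - assert (I : forall z, tube a b z /\ tc z = tc q -> tube a b z /\ 0 < tc z /\ norm1 z < d).
    { intros z [L T]. pose proof (tube_norm1 a b z Ha Hb L). rewrite T in *. split; [exact L|]. lra. }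
    apply (tube_level_same_sign a b (tc q)); auto.
    + now apply (rcont_sub _ _ f Hf).
    + apply S. lra.
Qed.

Lemma sqrt_norm_lip u v u' v' :
  sqrt (u ^ 2 + v ^ 2) <= sqrt (u' ^ 2 + v' ^ 2) + (Rabs (u - u') + Rabs (v - v')).
Proof.
  set (s := sqrt (u' ^ 2 + v' ^ 2)). assert (Hs : 0 <= s) by apply sqrt_pos.
  assert (Es : s ^ 2 = u' ^ 2 + v' ^ 2) by (apply pow2_sqrt; pose proof (pow2_ge_0 u'); pose proof (pow2_ge_0 v'); lra).
  set (x := u - u'). set (y := v - v').
  replace u with (u' + x) by (unfold x; ring). replace v with (v' + y) by (unfold y; ring).
  pose proof (Rabs_pos x). pose proof (Rabs_pos y).
  apply Rsqr_incr_0_var; [|lra]. rewrite Rsqr_sqrt by (pose proof (pow2_ge_0 (u' + x)); pose proof (pow2_ge_0 (v' + y)); lra).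
  unfold Rsqr.
  assert (A : - s <= u' <= s) by (apply sq_le_abs; [exact Hs|]; pose proof (pow2_ge_0 v'); lra).
  assert (B : - s <= v' <= s) by (apply sq_le_abs; [exact Hs|]; pose proof (pow2_ge_0 u'); lra).
  assert (- Rabs x <= x <= Rabs x) by (unfold Rabs; destruct Rcase_abs; lra).
  assert (- Rabs y <= y <= Rabs y) by (unfold Rabs; destruct Rcase_abs; lra).
  assert (u' * x <= s * Rabs x) by nra. assert (v' * y <= s * Rabs y) by nra.
  assert (x ^ 2 = Rabs x ^ 2) by (symmetry; apply pow2_abs).
  assert (y ^ 2 = Rabs y ^ 2) by (symmetry; apply pow2_abs). nra.
Qed.

(* Nearby points of a tube are joined inside the tube by a path of comparable size: project
   the segment radially. *)
Lemma tube_short_same_sign a b f p q : -1 <= a <= 1 -> - (1 / 2) <= b <= 1 / 2 ->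
  rcont (fun z => tube a b z /\ 0 < tc z /\ d1 z p <= 10 * d1 p q) f ->
  (forall z, tube a b z /\ 0 < tc z /\ d1 z p <= 10 * d1 p q -> f z <> 0) ->
  tube a b p -> 0 < tc p -> tube a b q -> 16 * d1 p q < tc p -> 0 < f p * f q.
Proof.
  intros Ha Hb Hf Hn Lp Tp Lq Hd. set (d := d1 p q) in *.
  set (A := fun z => d1 z p <= d).
  assert (HA : forall s, 0 <= s <= 1 -> A (lerp p q s)).
  { intros s Hs. unfold A. rewrite <- (lerp0 p q) at 2. rewrite d1_lerp, Rminus_0_r, Rabs_right by lra.
    fold d. pose proof (d1_pos p q). fold d in H. nra. }
  (* Along the segment the distance to the axis of the cone changes by at most [2 d] and the radius
     [t/4] by [d/4], which gives [9/4 d]. Two coordinates then cost [9/2 d] under projection, and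
     [d + 9/2 d <= 10 d]. The distance to the axis stays positive because [tc p / 4 > 4 d]. *)
  assert (R : forall z, A z -> 0 < tc z /\
    Rabs (sqrt ((xc z - a * tc z) ^ 2 + (yc z - b * tc z) ^ 2) - tc z / 4) <= 9 / 4 * d /\
    0 < sqrt ((xc z - a * tc z) ^ 2 + (yc z - b * tc z) ^ 2)).
  { intros z Hz. unfold A in Hz. pose proof (tube_radius a b p Lp) as Ep.
    destruct (d1_coord z p) as [_ [_ Ht]].
    pose proof (sqrt_norm_lip (xc z - a * tc z) (yc z - b * tc z) (xc p - a * tc p) (yc p - b * tc p)) as N1.
    pose proof (sqrt_norm_lip (xc p - a * tc p) (yc p - b * tc p) (xc z - a * tc z) (yc z - b * tc z)) as N2.
    rewrite (Rabs_minus_sym (xc p - _)), (Rabs_minus_sym (yc p - _)) in N2.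
    assert (Q : forall c u v, Rabs (u - c * tc z - (v - c * tc p)) <= Rabs (u - v) + Rabs c * Rabs (tc z - tc p)).
    { intros c u v. replace (u - c * tc z - (v - c * tc p)) with ((u - v) + - (c * (tc z - tc p))) by ring.
      eapply Rle_trans; [apply Rabs_triang|]. rewrite Rabs_Ropp, Rabs_mult. lra. }
    pose proof (Q a (xc z) (xc p)). pose proof (Q b (yc z) (yc p)).
    assert (Rabs a <= 1) by (apply Rabs_le; lra). assert (Rabs b <= 1) by (apply Rabs_le; lra).
    pose proof (Rabs_pos (tc z - tc p)).
    assert (Rabs (xc z - a * tc z - (xc p - a * tc p)) + Rabs (yc z - b * tc z - (yc p - b * tc p)) <= 2 * d)
      by (unfold d1 in Hz; pose proof (Rabs_pos (xc z - xc p)); pose proof (Rabs_pos (yc z - yc p)); nra).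
    assert (- d <= tc z - tc p <= d) by (revert Ht; unfold Rabs; destruct Rcase_abs; lra).
    rewrite Ep in N1, N2. split; [lra|]. split; [apply Rabs_le; lra|lra]. }
  assert (P : forall z, A z -> 0 < (xc z - a * tc z) ^ 2 + (yc z - b * tc z) ^ 2).
  { intros z Hz. destruct (R z Hz) as [_ [_ H]]. apply Rnot_le_lt. intros H'.
    rewrite sqrt_neg_0 in H by exact H'. lra. }
  assert (M : forall z, A z -> tube a b (tube_proj a b z) /\ 0 < tc (tube_proj a b z) /\ d1 (tube_proj a b z) p <= 10 * d).
  { intros z Hz. destruct (R z Hz) as [R1 [R2 R3]]. specialize (P z Hz).
    split; [apply tube_proj_tube; lra|]. split; [exact R1|].
    eapply Rle_trans; [apply (d1_triangle _ z)|]. unfold A in Hz.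
    cut (d1 (tube_proj a b z) z <= 9 / 2 * d); [pose proof (d1_pos p q) as Dp; fold d in Dp; lra|].
    unfold d1, tube_proj.
    set (u := xc z - a * tc z) in *. set (v := yc z - b * tc z) in *. set (s := sqrt (u ^ 2 + v ^ 2)) in *.
    change (Rabs (a * tc z + u * (tc z / 4 / s) - xc z) + Rabs (b * tc z + v * (tc z / 4 / s) - yc z)
       + Rabs (tc z - tc z) <= 9 / 2 * d).
    replace (a * tc z + u * (tc z / 4 / s) - xc z) with (- (u / s * (s - tc z / 4))) by (unfold u; field; lra).
    replace (b * tc z + v * (tc z / 4 / s) - yc z) with (- (v / s * (s - tc z / 4))) by (unfold v; field; lra).
    rewrite !Rabs_Ropp, !Rabs_mult, Rminus_diag, Rabs_R0.
    assert (Es : s ^ 2 = u ^ 2 + v ^ 2) by (apply pow2_sqrt; lra).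
    assert (B : forall w, w ^ 2 <= s ^ 2 -> Rabs (w / s) <= 1).
    { intros w Hw. unfold Rdiv. rewrite Rabs_mult, Rabs_inv, (Rabs_right s) by lra.
      apply (Rmult_le_reg_r s); [exact R3|]. rewrite Rmult_assoc, Rinv_l by lra.
      assert (- s <= w <= s) by (apply sq_le_abs; lra). assert (Rabs w <= s) by (apply Rabs_le; lra). lra. }
    pose proof (B u ltac:(pose proof (pow2_ge_0 v); lra)). pose proof (B v ltac:(pose proof (pow2_ge_0 u); lra)).
    pose proof (Rabs_pos (s - tc z / 4)). nra. }
  assert (Tq : 0 < tc q).
  { apply (R q). unfold A. rewrite d1_sym. apply Rle_refl. }
  rewrite <- (tube_proj_id a b p Lp Tp), <- (tube_proj_id a b q Lq Tq).
  apply (segment_same_sign A (fun z => f (tube_proj a b z))); auto.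
  apply (rcont_comp _ (fun z => tube a b z /\ 0 < tc z /\ d1 z p <= 10 * d)); [exact Hf| |exact M].
  now apply pcont_tube_proj.
Qed.

(** * No ambient bi-Lipschitz equivalence *)

(** An ambient bi-Lipschitz germ with its neighbourhoods replaced by one [norm1]-ball, and with one
    constant for both directions. *)
Record lip_germ (k : nat) (H G : pt -> pt) (d M : R) : Prop := {
  germ_d : 0 < d;
  germ_M : 1 <= M;
  germ_GH : forall p, norm1 p < d -> G (H p) = p;
  germ_HG : forall q, norm1 q < d -> H (G q) = q;
  germ_H : forall p q, norm1 p < d -> norm1 q < d -> d1 (H p) (H q) <= M * d1 p q;
  germ_G : forall p q, norm1 p < d -> norm1 q < d -> d1 (G p) (G q) <= M * d1 p q;
  germ_H0 : H origin = origin;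
  germ_G0 : G origin = origin;
  germ_X1 : forall p, norm1 p < d -> X1 k p -> X2 k (H p);
  germ_X2 : forall q, norm1 q < d -> X2 k q -> X1 k (G q) }.

Lemma dist_sym p q : dist p q = dist q p.
Proof. destruct p as [[x y] t], q as [[x' y'] t']. unfold dist. f_equal. ring. Qed.

Lemma lip_germ_of_equiv k : ambient_lip_equiv (X1 k) (X2 k) -> exists H G d M, lip_germ k H G d M.
Proof.
  intros (U & V & H & G & L & (OU & OV & U0 & V0 & H0 & HU & GV & GH & HG & _ & _ & r & Hr & HX) & HL & Hlip).
  destruct (OU _ U0) as [a [Ha BU]]. destruct (OV _ V0) as [b [Hb BV]].
  (* The 2 is the loss between [d1] and [dist], the 1 ensures [M >= 1]. The bound [r / M] in the
     radius makes [H] send the ball into the region where the image of [X1] is known to be [X2]. *)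
  set (M := 2 * L + 1). assert (HM : 1 <= M) by (unfold M; lra).
  set (d := Rmin (Rmin a b) (r / M)).
  assert (HrM : 0 < r / M) by (apply Rdiv_lt_0_compat; lra).
  assert (Hd : 0 < d) by (repeat apply Rmin_glb_lt; assumption).
  assert (da : d <= a) by (eapply Rle_trans; [apply Rmin_l|apply Rmin_l]).
  assert (db : d <= b) by (eapply Rle_trans; [apply Rmin_l|apply Rmin_r]).
  assert (dr : d * M <= r).
  { replace r with (r / M * M) by (field; lra). apply Rmult_le_compat_r; [lra|apply Rmin_r]. }
  assert (ND : forall p, dist p origin <= norm1 p) by (intros; apply dist_le_d1).
  assert (IU : forall p, norm1 p < d -> U p).
  { intros p Hp. apply BU. rewrite dist_sym. specialize (ND p). lra. }
  assert (IV : forall p, norm1 p < d -> V p).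
  { intros p Hp. apply BV. rewrite dist_sym. specialize (ND p). lra. }
  exists H, G, d, M. split; auto.
  - intros p q Hp Hq. destruct (Hlip p q (IU p Hp) (IU q Hq)) as [E _].
    pose proof (d1_le_dist (H p) (H q)). pose proof (dist_le_d1 p q). pose proof (d1_pos p q). unfold M. nra.
  - intros p q Hp Hq. destruct (Hlip (G p) (G q) (GV p (IV p Hp)) (GV q (IV q Hq))) as [_ E].
    rewrite !HG in E by auto.
    pose proof (d1_le_dist (G p) (G q)). pose proof (dist_le_d1 p q). pose proof (d1_pos p q). unfold M. nra.
  - rewrite <- H0 at 1. auto.
  - intros p Hp Xp. apply HX; [|exists p; auto].
    rewrite <- H0. destruct (Hlip p origin (IU p Hp) U0) as [E _]. specialize (ND p).
    pose proof (d1_pos p origin) as P. fold (norm1 p) in P. unfold M in *.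
    assert (L * dist p origin <= L * norm1 p) by (apply Rmult_le_compat_l; lra). nra.
  - intros q Hq Xq. assert (dist q origin < r) by (specialize (ND q); nra).
    destruct (proj1 (HX q H1) Xq) as [p [Up [Xp <-]]]. now rewrite GH.
Qed.

(** * Sign functions separating the pieces, and the size of the neck *)

Definition marker (k : nat) (p : pt) : R := quartic k (xc p) (yc p) (tc p) + tc p ^ 4 / 2.

Lemma rcont_marker k A : rcont A (marker k).
Proof. unfold marker, quartic. rcont_auto. intros; lra. Qed.

Lemma marker_loop k p : loop k p -> 0 < tc p -> 0 < marker k p.
Proof. intros [H _] Ht. unfold marker. rewrite H. pose proof (pow_lt _ 4 Ht). lra. Qed.

Lemma marker_tube k a b p : a = 1 \/ a = -1 -> - (1 / 2) <= b <= 1 / 2 -> tube a b p -> 0 < tc p -> marker k p < 0.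
Proof.
  intros Ha Hb H Ht. destruct (tube_in_lobe a b p a H Ha eq_refl Hb). now apply (lobe_quartic_neg k p a).
Qed.

Lemma X1_cases k p : (0 < k)%nat -> X1 k p -> p <> origin ->
  0 < tc p /\ (loop k p /\ 0 < marker k p \/
    marker k p < 0 /\ (tube 1 (1 / 2) p /\ 0 < yc p \/ tube 1 (- 1 / 2) p /\ yc p < 0)).
Proof.
  intros hk H Hp. apply X1_pieces in H.
  assert (Ht : 0 < tc p).
  { destruct H as [H|[H|H]]; [|now apply (tube_pos 1 (1 / 2))|now apply (tube_pos 1 (- 1 / 2))].
    destruct (Req_dec (tc p) 0) as [Z|Z]; [|destruct H; lra]. exfalso. apply Hp. now apply (loop_0 k). }
  split; [exact Ht|]. destruct H as [H|[H|H]].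
  - left. split; [exact H|now apply marker_loop].
  - right. split; [apply (marker_tube k 1 (1 / 2)); auto; lra|]. left. split; [exact H|].
    destruct (tube_bounds _ _ _ H). lra.
  - right. split; [apply (marker_tube k 1 (- 1 / 2)); auto; lra|]. right. split; [exact H|].
    destruct (tube_bounds _ _ _ H). lra.
Qed.

Lemma X2_cases k p : (0 < k)%nat -> X2 k p -> p <> origin ->
  0 < tc p /\ (loop k p /\ 0 < marker k p \/
    marker k p < 0 /\ (tube 1 0 p /\ 0 < xc p \/ tube (-1) 0 p /\ xc p < 0)).
Proof.
  intros hk H Hp. apply X2_pieces in H.
  assert (Ht : 0 < tc p).
  { destruct H as [H|[H|H]]; [|now apply (tube_pos 1 0)|now apply (tube_pos (-1) 0)].
    destruct (Req_dec (tc p) 0) as [Z|Z]; [|destruct H; lra]. exfalso. apply Hp. now apply (loop_0 k). }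
  split; [exact Ht|]. destruct H as [H|[H|H]].
  - left. split; [exact H|now apply marker_loop].
  - right. split; [apply (marker_tube k 1 0); auto; lra|]. left. split; [exact H|].
    destruct (tube_bounds _ _ _ H). lra.
  - right. split; [apply (marker_tube k (-1) 0); auto; lra|]. right. split; [exact H|].
    destruct (tube_bounds _ _ _ H). lra.
Qed.

(** On [y = 0] a loop point is off the t-axis and outside both discs of [loop_outside], so
    [|x| >= 2 t]; the tubes give the weaker bound. *)
Lemma X2_axis k p : X2 k p -> 0 < tc p -> yc p = 0 -> 3 / 4 * tc p <= Rabs (xc p).
Proof.
  intros H Ht Hy. apply X2_pieces in H. destruct H as [H|[H|H]].
  - destruct (loop_outside k p H) as [H1 H2]. pose proof (loop_off_axis k p H Ht). rewrite Hy in *.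
    assert (xc p <> 0) by (intros E; rewrite E in *; nra).
    unfold Rabs. destruct Rcase_abs; nra.
  - apply (tube_far 1 0); auto.
  - apply (tube_far (-1) 0); auto.
Qed.

(* [t^(k/4)], half the width of the neck. *)
Definition neck (k : nat) (t : R) : R := sqrt (sqrt (t ^ k)).

Lemma neck_pos k t : 0 < t -> 0 < neck k t.
Proof. intros H. now apply sqrt_lt_R0, sqrt_lt_R0, pow_lt. Qed.

Lemma neck_pow k t : 0 < t -> neck k t ^ 4 = t ^ k.
Proof.
  intros H. unfold neck. replace (sqrt (sqrt (t ^ k)) ^ 4) with ((sqrt (sqrt (t ^ k)) ^ 2) ^ 2) by ring.
  rewrite pow2_sqrt by apply sqrt_pos. apply pow2_sqrt. left. now apply pow_lt.
Qed.

Lemma pow4_le_inv a b : 0 <= b -> a ^ 4 <= b ^ 4 -> a <= b.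
Proof.
  intros Hb H. apply Rnot_lt_le. intros L. assert (b ^ 2 < a ^ 2) by nra.
  assert ((b ^ 2) ^ 2 < (a ^ 2) ^ 2) by (pose proof (pow2_ge_0 b); nra). nra.
Qed.

(** In [t^k = t^4 * t * t^(k-5)] the spare factor [t], available because [k > 4], is bounded by
    [e^4]. *)
Lemma neck_small k t e : (4 < k)%nat -> 0 < e <= 1 -> 0 < t -> t <= e ^ 4 -> neck k t <= e * t.
Proof.
  intros hk He Ht H. apply pow4_le_inv; [nra|]. rewrite neck_pow by exact Ht.
  assert (e ^ 4 <= 1) by (rewrite <- (pow1 4); apply pow_incr; lra).
  replace k with (4 + (1 + (k - 5)))%nat by lia. rewrite !pow_add, pow_1.
  assert (t ^ (k - 5) <= 1) by (rewrite <- (pow1 (k - 5)); apply pow_incr; lra).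
  pose proof (pow_lt t (k - 5) Ht). pose proof (pow_lt t 4 Ht). pose proof (pow_lt e 4 (proj1 He)).
  replace ((e * t) ^ 4) with (t ^ 4 * e ^ 4) by ring.
  apply Rmult_le_compat_l; [lra|]. nra.
Qed.

Lemma neck_loop k t e : 0 < t -> e = 1 \/ e = -1 -> loop k (0, e * neck k t, t).
Proof.
  intros Ht He. unfold loop, quartic, xc, yc, tc; cbn [fst snd]. split; [|lra].
  rewrite <- (neck_pow k t Ht). destruct He; subst e; ring.
Qed.

(** With [n = x^2 + y^2] the equation gives [n^2 <= 4 n t^2 + t^4], hence [n <= 5 t^2]; then [|x|]
    and [|y|] are at most [3 t]. *)
Lemma loop_norm1 k p : (4 <= k)%nat -> loop k p -> tc p <= 1 -> norm1 p <= 7 * tc p.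
Proof.
  intros hk [H Ht] H1. unfold quartic in H. rewrite norm1_def.
  set (x := xc p) in *. set (y := yc p) in *. set (t := tc p) in *.
  assert (Hk : t ^ k <= t ^ 4).
  { replace k with (4 + (k - 4))%nat by lia. rewrite pow_add.
    assert (t ^ (k - 4) <= 1) by (rewrite <- (pow1 (k - 4)); apply pow_incr; lra).
    pose proof (pow_le t 4 Ht). nra. }
  pose proof (pow2_ge_0 x). pose proof (pow2_ge_0 y). pose proof (pow2_ge_0 t).
  assert (E : (x ^ 2 + y ^ 2) ^ 2 <= 4 * (x ^ 2 + y ^ 2) * t ^ 2 + (t ^ 2) ^ 2).
  { replace ((x ^ 2 + y ^ 2) ^ 2) with ((x ^ 2 - 2 * x * t + y ^ 2) * (x ^ 2 + 2 * x * t + y ^ 2) + 4 * x ^ 2 * t ^ 2) by ring.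
    replace ((t ^ 2) ^ 2) with (t ^ 4) by ring. nra. }
  assert (N : x ^ 2 + y ^ 2 <= 5 * t ^ 2).
  { set (n := x ^ 2 + y ^ 2) in *. set (s := t ^ 2) in *. assert (0 <= n) by (unfold n; lra).
    apply Rnot_lt_le. intros L. nra. }
  assert (Rabs x <= 3 * t) by (apply Rabs_le, sq_le_abs; nra).
  assert (Rabs y <= 3 * t) by (apply Rabs_le, sq_le_abs; nra).
  rewrite (Rabs_right t) by lra. lra.
Qed.

(* Vanishes exactly on the loop and is negative exactly inside it, for all real [t]. *)
Definition side (k : nat) (p : pt) : R :=
  quartic k (xc p) (yc p) (Rmax 0 (tc p)) + Rmax 0 (- tc p).

Lemma rcont_side k A : rcont A (side k).
Proof. unfold side, quartic. rcont_auto. Qed.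

Lemma side_pos k p : 0 <= tc p -> side k p = quartic k (xc p) (yc p) (tc p).
Proof. intros Ht. unfold side. rewrite (Rmax_right 0 (tc p)), (Rmax_left 0 (- tc p)) by lra. ring. Qed.

Lemma side_nonpos k p : (0 < k)%nat -> tc p <= 0 -> side k p = (xc p ^ 2 + yc p ^ 2) ^ 2 - tc p.
Proof.
  intros hk Ht. unfold side, quartic. rewrite (Rmax_left 0 (tc p)), (Rmax_right 0 (- tc p)) by lra.
  rewrite pow_i by exact hk. ring.
Qed.

Lemma side_0 k p : (0 < k)%nat -> side k p = 0 -> loop k p.
Proof.
  intros hk H. destruct (Rle_or_lt 0 (tc p)) as [Ht|Ht].
  - split; [|exact Ht]. now rewrite <- side_pos.
  - rewrite side_nonpos in H by (auto; lra). pose proof (pow2_ge_0 (xc p ^ 2 + yc p ^ 2)). lra.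
Qed.

Lemma side_neg k p : (0 < k)%nat -> side k p < 0 -> 0 < tc p /\ quartic k (xc p) (yc p) (tc p) < 0.
Proof.
  intros hk H. destruct (Rlt_or_le 0 (tc p)) as [Ht|Ht].
  - split; [exact Ht|]. rewrite <- side_pos; lra.
  - rewrite side_nonpos in H by auto. pose proof (pow2_ge_0 (xc p ^ 2 + yc p ^ 2)). lra.
Qed.

(** * The action of a hypothetical bi-Lipschitz germ on the pieces *)

Section Germ.
Context (k : nat) (hk : (4 < k)%nat) (H G : pt -> pt) (d M : R) (germ : lip_germ k H G d M).

Let hk0 : (0 < k)%nat.
Proof. lia. Qed.

Let Hd : 0 < d := germ_d _ _ _ _ _ germ.
Let HM : 1 <= M := germ_M _ _ _ _ _ germ.

Lemma germ_H_norm p : norm1 p < d -> norm1 (H p) <= M * norm1 p.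
Proof.
  intros Hp. unfold norm1 at 1. rewrite <- (germ_H0 _ _ _ _ _ germ).
  apply (germ_H _ _ _ _ _ germ); [exact Hp|]. now rewrite norm1_origin.
Qed.

Lemma germ_G_norm p : norm1 p < d -> norm1 (G p) <= M * norm1 p.
Proof.
  intros Hp. unfold norm1 at 1. rewrite <- (germ_G0 _ _ _ _ _ germ).
  apply (germ_G _ _ _ _ _ germ); [exact Hp|]. now rewrite norm1_origin.
Qed.

Lemma lip_pcont F : (forall p q, norm1 p < d -> norm1 q < d -> d1 (F p) (F q) <= M * d1 p q) ->
  pcont (fun p => norm1 p < d) F.
Proof.
  intros L. apply pcont_d1. intros p Hp e He. exists (e / M). split; [apply Rdiv_lt_0_compat; lra|].
  intros q Hq E. eapply Rle_lt_trans; [now apply L|].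
  apply (Rmult_lt_compat_l M) in E; [|lra]. now replace (M * (e / M)) with e in E by (field; lra).
Qed.

Lemma rcont_H A f : (forall p, A p -> norm1 p < d) -> rcont (fun _ => True) f -> rcont A (fun p => f (H p)).
Proof.
  intros HA Hf. apply (rcont_comp A (fun _ => True)); [exact Hf| |auto].
  apply (pcont_sub A (fun p => norm1 p < d)); [|exact HA]. apply lip_pcont, (germ_H _ _ _ _ _ germ).
Qed.

Lemma rcont_G A f : (forall p, A p -> norm1 p < d) -> rcont (fun _ => True) f -> rcont A (fun p => f (G p)).
Proof.
  intros HA Hf. apply (rcont_comp A (fun _ => True)); [exact Hf| |auto].
  apply (pcont_sub A (fun p => norm1 p < d)); [|exact HA]. apply lip_pcont, (germ_G _ _ _ _ _ germ).
Qed.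

Lemma H_not_origin p : norm1 p < d -> 0 < tc p -> H p <> origin.
Proof.
  intros Hp Ht E. apply (tc_not_origin p Ht).
  rewrite <- (germ_GH _ _ _ _ _ germ p Hp), E. apply (germ_G0 _ _ _ _ _ germ).
Qed.

Lemma G_not_origin p : norm1 p < d -> 0 < tc p -> G p <> origin.
Proof.
  intros Hp Ht E. apply (tc_not_origin p Ht).
  rewrite <- (germ_HG _ _ _ _ _ germ p Hp), E. apply (germ_H0 _ _ _ _ _ germ).
Qed.

(* If the loop of [X2] were carried into a tube, the two sides of its neck, at distance
   [2 t^(k/4)], would be joined by a path of comparable diameter in the tube; its image in
   [X2] would cross [y = 0] close to the t-axis, where [X2] has no points. *)
Lemma loop_to_loop : exists t0, 0 < t0 /\
  forall q, loop k q -> 0 < tc q < t0 -> norm1 q < d /\ 0 < marker k (G q).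
Proof.
  (* With [w <= e t] one gets [w M^2 <= t / 1000]. This leaves room for the excursion [20 w M^2]
     around the neck and for the requirement [16 d1 a b < tc a], which amounts to [96 w M^2 < t]. *)
  set (e := / (1000 * M ^ 2)).
  assert (HM2 : 1 <= M ^ 2) by nra.
  assert (He0 : 0 < e) by (apply Rinv_0_lt_compat; lra).
  assert (EeM : e * M ^ 2 = / 1000) by (unfold e; field; lra).
  assert (He1 : e <= 1) by nra.
  (* [e^4] is the threshold of [neck_small]; [30 M t < d] keeps the images of the section, of norm
     at most [7 M t], and the short paths near them inside the ball. *)
  exists (Rmin (e ^ 4) (d / (30 * M))).
  split; [apply Rmin_glb_lt; [now apply pow_lt|apply Rdiv_lt_0_compat; lra]|].
  intros q Lq [Tq Tq']. set (t := tc q) in *.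
  assert (T1 : t < e ^ 4) by (eapply Rlt_le_trans; [exact Tq'|apply Rmin_l]).
  assert (T2 : 30 * M * t < d).
  { assert (t < d / (30 * M)) as T by (eapply Rlt_le_trans; [exact Tq'|apply Rmin_r]).
    apply (Rmult_lt_compat_l (30 * M)) in T; [|lra]. now replace (30 * M * (d / (30 * M))) with d in T by (field; lra). }
  assert (T3 : t <= 1).
  { assert (e ^ 4 <= 1) by (rewrite <- (pow1 4); apply pow_incr; lra). lra. }
  assert (Mt : t <= M * t) by nra.
  set (w := neck k t). assert (Hw : 0 < w) by now apply neck_pos.
  assert (Hw' : w <= e * t) by (apply neck_small; auto; lra).
  assert (HwM : w * M ^ 2 <= t / 1000) by nra.
  assert (HwM1 : w * M <= w * M ^ 2) by (apply Rmult_le_compat_l; nra).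
  assert (LN : forall z, loop k z /\ tc z = t -> norm1 z < d).
  { intros z [L T]. pose proof (loop_norm1 k z ltac:(lia) L ltac:(lra)). nra. }
  split; [now apply LN|].
  assert (GX : forall z, loop k z /\ tc z = t -> X1 k (G z) /\ G z <> origin).
  { intros z Hz. split; [|apply G_not_origin; [now apply LN|destruct Hz; lra]].
    apply (germ_X2 _ _ _ _ _ germ); [now apply LN|]. apply X2_pieces. now left. }
  assert (MN : forall z, loop k z /\ tc z = t -> marker k (G z) <> 0).
  { intros z Hz. destruct (GX z Hz) as [X O]. destruct (X1_cases k _ hk0 X O) as [_ [[_ ?]|[? _]]]; lra. }
  assert (MS : forall z z', loop k z /\ tc z = t -> loop k z' /\ tc z' = t -> 0 < marker k (G z) * marker k (G z')).
  { intros z z' [L T] [L' T']. apply (loop_same_sign k t (fun z => marker k (G z))); auto.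
    apply rcont_G; [exact LN|apply rcont_marker]. }
  apply Rnot_le_lt. intros Neg.
  assert (AllNeg : forall z, loop k z /\ tc z = t -> marker k (G z) < 0).
  { intros z Hz. specialize (MS q z (conj Lq eq_refl) Hz). nra. }
  assert (YN : forall z, loop k z /\ tc z = t -> yc (G z) <> 0).
  { intros z Hz. destruct (GX z Hz) as [X O]. specialize (AllNeg z Hz).
    destruct (X1_cases k _ hk0 X O) as [_ [[_ ?]|[_ [[_ ?]|[_ ?]]]]]; lra. }
  set (q1 := (0, 1 * w, t) : pt). set (q2 := (0, -1 * w, t) : pt).
  assert (L1 : loop k q1 /\ tc q1 = t) by (split; [apply neck_loop; auto|reflexivity]).
  assert (L2 : loop k q2 /\ tc q2 = t) by (split; [apply neck_loop; auto|reflexivity]).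
  (* The whole section goes into the tubes, where [y] does not vanish, so both sides of the neck
     land in the same tube. *)
  assert (YS : 0 < yc (G q1) * yc (G q2)).
  { apply (loop_same_sign k t (fun z => yc (G z))); try tauto.
    apply rcont_G; [exact LN|apply rcont_yc]. }
  set (a := G q1) in *. set (b := G q2) in *.
  assert (D12 : d1 q1 q2 = 2 * w).
  { unfold d1, q1, q2, xc, yc, tc; cbn [fst snd]. rewrite !Rminus_diag, Rabs_R0, Rabs_right by lra. lra. }
  assert (Dab : d1 a b <= M * (2 * w)).
  { rewrite <- D12. apply (germ_G _ _ _ _ _ germ); now apply LN. }
  assert (Tube : exists s, - (1 / 2) <= s <= 1 / 2 /\ tube 1 s a /\ tube 1 s b /\ 0 < tc a /\
    forall z, tube 1 s z -> X1 k z).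
  { destruct (GX q1 L1) as [Xa Oa]. destruct (GX q2 L2) as [Xb Ob].
    pose proof (AllNeg q1 L1) as Na. pose proof (AllNeg q2 L2) as Nb. fold a in Xa, Oa, Na. fold b in Xb, Ob, Nb.
    destruct (X1_cases k a hk0 Xa Oa) as [Ta [[_ ?]|[_ [[? ?]|[? ?]]]]]; [lra| |];
    destruct (X1_cases k b hk0 Xb Ob) as [Tb [[_ ?]|[_ [[? ?]|[? ?]]]]]; try lra; try nra.
    - exists (1 / 2). split; [lra|]. repeat (split; [assumption|]).
      intros z Hz. apply X1_pieces. now right; left.
    - exists (- 1 / 2). split; [lra|]. repeat (split; [assumption|]).
      intros z Hz. apply X1_pieces. now right; right. }
  destruct Tube as [s [Hs [Ha [Hb [Ta HsX]]]]].
  assert (Ha' : norm1 a <= M * (7 * t)).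
  { eapply Rle_trans; [apply germ_G_norm; now apply LN|]. apply Rmult_le_compat_l; [lra|].
    destruct L1 as [L1 T1']. rewrite <- T1'. apply (loop_norm1 k); [lia|exact L1|lra]. }
  (* Mapping [a] back by [H] bounds its norm from below, and on a tube the norm is at most three
     times the height. *)
  assert (Ta' : t <= 3 * (M * tc a)).
  { pose proof (tube_norm1 1 s a ltac:(lra) Hs Ha).
    assert (norm1 q1 <= M * norm1 a).
    { rewrite <- (germ_HG _ _ _ _ _ germ q1) by now apply LN. apply germ_H_norm. fold a. nra. }
    destruct (norm1_coord q1) as [_ [_ E]]. change (tc q1) with t in E. rewrite Rabs_right in E by lra. nra. }
  set (A := fun z => tube 1 s z /\ 0 < tc z /\ d1 z a <= 10 * d1 a b).
  assert (AN : forall z, A z -> norm1 z < d).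
  { intros z [_ [_ Z]]. pose proof (d1_triangle z a origin) as T. fold (norm1 z) (norm1 a) in T. nra. }
  assert (Na : norm1 a < d) by nra.
  assert (P : 0 < yc (H a) * yc (H b)).
  { apply (tube_short_same_sign 1 s (fun z => yc (H z)) a b); auto; try lra.
    - apply (rcont_H A); [exact AN|apply rcont_yc].
    - intros z Hz. pose proof (AN z Hz) as Nz. destruct Hz as [Z1 [Z2 Z3]]. intros Y0.
      assert (D : d1 (H z) q1 <= 20 * (w * M ^ 2)).
      { rewrite <- (germ_HG _ _ _ _ _ germ q1) by now apply LN. fold a.
        eapply Rle_trans; [now apply (germ_H _ _ _ _ _ germ)|]. nra. }
      assert (X : X2 k (H z)).
      { apply (germ_X1 _ _ _ _ _ germ); [exact Nz|now apply HsX]. }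
      destruct (d1_coord (H z) q1) as [Dx [_ Dt]]. change (xc q1) with 0 in Dx. change (tc q1) with t in Dt.
      rewrite Rminus_0_r in Dx.
      assert (t - tc (H z) <= 20 * (w * M ^ 2)).
      { rewrite Rabs_minus_sym in Dt. pose proof (Rle_abs (t - tc (H z))). lra. }
      pose proof (X2_axis k (H z) X ltac:(lra) Y0). lra.
    - nra. }
  unfold a, b in P. rewrite !(germ_HG _ _ _ _ _ germ) in P by now apply LN.
  unfold q1, q2, yc in P; cbn [fst snd] in P. nra.
Qed.

(** If [H p] were on the loop, [loop_to_loop] would make [marker] positive at [G (H p) = p]. The
    radius [t0 / M] keeps the height of [H p] below [t0]. *)
Lemma tube_to_tube : exists r, 0 < r <= d /\
  forall p, norm1 p < r -> X1 k p -> 0 < tc p -> marker k p < 0 -> X2 k (H p) /\ marker k (H p) < 0.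
Proof.
  destruct loop_to_loop as [t0 [Ht0 L]].
  exists (Rmin d (t0 / M)).
  assert (0 < t0 / M) by (apply Rdiv_lt_0_compat; lra).
  split; [split; [now apply Rmin_glb_lt|apply Rmin_l]|]. intros p Np Xp Tp Mp.
  assert (Np1 : norm1 p < d) by (eapply Rlt_le_trans; [exact Np|apply Rmin_l]).
  assert (Np2 : M * norm1 p < t0).
  { assert (norm1 p < t0 / M) as N by (eapply Rlt_le_trans; [exact Np|apply Rmin_r]).
    apply (Rmult_lt_compat_l M) in N; [|lra]. now replace (M * (t0 / M)) with t0 in N by (field; lra). }
  pose proof (germ_X1 _ _ _ _ _ germ p Np1 Xp) as X. split; [exact X|].
  destruct (X2_cases k (H p) hk0 X (H_not_origin p Np1 Tp)) as [T [[Lp _]|[Mn _]]]; [|exact Mn].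
  exfalso. pose proof (germ_H_norm p Np1). destruct (norm1_coord (H p)) as [_ [_ E]].
  pose proof (Rle_abs (tc (H p))).
  destruct (L (H p) Lp ltac:(lra)) as [_ P]. rewrite (germ_GH _ _ _ _ _ germ p Np1) in P. lra.
Qed.

(** [G] sends the connected punctured tube away from the loop, since [marker] is negative at one
    image point, and then into a single tube of [X1], since [y] has no zeros there. The points [a]
    and [b] may have different heights. *)
Lemma X2_tube_same_side c a b : c = 1 \/ c = -1 -> tube c 0 a -> tube c 0 b -> 0 < tc a -> 0 < tc b ->
  norm1 a < d -> norm1 b < d -> 3 * tc a < d -> 3 * tc b < d -> marker k (G a) < 0 -> 0 < yc (G a) * yc (G b).
Proof.
  intros Hc Ha Hb Ta Tb Na Nb Da Db Ma.
  assert (Hc' : -1 <= c <= 1) by lra.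
  set (A := fun z => tube c 0 z /\ 0 < tc z /\ norm1 z < d).
  assert (GX : forall z, A z -> X1 k (G z) /\ G z <> origin).
  { intros z [Z1 [Z2 Z3]]. split; [|now apply G_not_origin].
    apply (germ_X2 _ _ _ _ _ germ); [exact Z3|]. apply X2_pieces. destruct Hc; subst c; tauto. }
  assert (MN : forall z, A z -> marker k (G z) < 0).
  { intros z Hz. assert (0 < marker k (G z) * marker k (G a)); [|nra].
    destruct Hz as [Z1 [Z2 Z3]].
    apply (tube_same_sign c 0 d (fun z => marker k (G z))); auto; try lra.
    - apply (rcont_G A); [now intros w [_ [_ W]]|apply rcont_marker].
    - intros w Hw. destruct (GX w Hw) as [X O]. destruct (X1_cases k _ hk0 X O) as [_ [[_ ?]|[? _]]]; lra. }
  apply (tube_same_sign c 0 d (fun z => yc (G z))); auto; try lra.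
  - apply (rcont_G A); [now intros w [_ [_ W]]|apply rcont_yc].
  - intros z Hz. destruct (GX z Hz) as [X O]. specialize (MN z Hz).
    destruct (X1_cases k _ hk0 X O) as [_ [[_ ?]|[_ [[_ ?]|[_ ?]]]]]; lra.
Qed.

(* The segment between the tubes of [X1] is far from the loop, but its image joins tubes
   lying in different lobes, hence runs through the neck of the loop of [X2]. *)
Lemma lip_germ_absurd : False.
Proof.
  destruct loop_to_loop as [t0 [Ht0 L]]. destruct tube_to_tube as [r [[Hr Hrd] T]].
  set (e := / (1000 * M ^ 2)).
  assert (HM2 : 1 <= M ^ 2) by nra.
  assert (He0 : 0 < e) by (apply Rinv_0_lt_compat; lra).
  assert (EeM : e * M ^ 2 = / 1000) by (unfold e; field; lra).
  assert (He1 : e <= 1) by nra.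
  assert (He4 : 0 < e ^ 4) by now apply pow_lt.
  (* All smallness conditions at once; with [t = m / (10 M)] the segment, of norm at most [3 t], and
     its image, of norm at most [3 M t], satisfy them. *)
  set (m := Rmin (Rmin r t0) (Rmin (e ^ 4) d)).
  assert (Hm : 0 < m) by (repeat apply Rmin_glb_lt; assumption).
  assert (m1 : m <= r) by (eapply Rle_trans; [apply Rmin_l|apply Rmin_l]).
  assert (m2 : m <= t0) by (eapply Rle_trans; [apply Rmin_l|apply Rmin_r]).
  assert (m3 : m <= e ^ 4) by (eapply Rle_trans; [apply Rmin_r|apply Rmin_l]).
  assert (m4 : m <= d) by (eapply Rle_trans; [apply Rmin_r|apply Rmin_r]).
  set (t := m / (10 * M)). assert (Ht : 0 < t) by (apply Rdiv_lt_0_compat; lra).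
  assert (Et : 10 * (M * t) = m) by (unfold t; field; lra). clearbody t m.
  assert (Mt : t <= M * t) by nra.
  (* The segment joins the lowest point of the upper tube to the highest point of the lower one,
     within [t/4] of the centre of the right disc. *)
  set (A := fun z => xc z = t /\ tc z = t /\ - (t / 4) <= yc z <= t / 4).
  assert (AN : forall z, A z -> norm1 z <= 3 * t).
  { intros z [Zx [Zt Zy]]. rewrite norm1_def, Zx, Zt, Rabs_right by lra.
    assert (Rabs (yc z) <= t / 4) by (apply Rabs_le; lra). lra. }
  assert (ANd : forall z, A z -> norm1 z < d) by (intros z Hz; specialize (AN z Hz); lra).
  assert (HN : forall z, A z -> norm1 (H z) <= 3 * (M * t)).
  { intros z Hz. pose proof (germ_H_norm z (ANd z Hz)). specialize (AN z Hz). nra. }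
  assert (HT : forall z, A z -> tc (H z) <= 3 * (M * t)).
  { intros z Hz. specialize (HN z Hz). destruct (norm1_coord (H z)) as [_ [_ E]]. pose proof (Rle_abs (tc (H z))). lra. }
  assert (AQ : forall z, A z -> (xc z - 1 * tc z) ^ 2 + yc z ^ 2 <= (3 / 4 * tc z) ^ 2).
  { intros z [Zx [Zt Zy]]. rewrite Zx, Zt. nra. }
  set (p1 := (t, t / 4, t) : pt). set (p2 := (t, - (t / 4), t) : pt).
  assert (A1 : A p1) by (unfold A, p1, xc, yc, tc; cbn [fst snd]; lra).
  assert (A2 : A p2) by (unfold A, p2, xc, yc, tc; cbn [fst snd]; lra).
  assert (B1 : tube 1 (1 / 2) p1) by (unfold tube, p1, xc, yc, tc; cbn [fst snd]; split; [field|lra]).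
  assert (B2 : tube 1 (- 1 / 2) p2) by (unfold tube, p2, xc, yc, tc; cbn [fst snd]; split; [field|lra]).
  destruct (T p1) as [X1' M1]; [specialize (AN p1 A1); lra|apply X1_pieces; tauto|exact Ht
    |apply (marker_tube k 1 (1 / 2)); auto; lra|].
  destruct (T p2) as [X2' M2]; [specialize (AN p2 A2); lra|apply X1_pieces; tauto|exact Ht
    |apply (marker_tube k 1 (- 1 / 2)); auto; lra|].
  (* A zero of [side] is a loop point; its preimage [z] would then have a positive [marker], whereas
     the segment lies deep in the lobe. *)
  assert (SN : forall z, A z -> side k (H z) <> 0).
  { intros z Hz E. apply side_0 in E; [|exact hk0].
    assert (O : 0 < tc (H z)).
    { destruct (Req_dec (tc (H z)) 0) as [Z|Z]; [|destruct E; lra]. exfalso.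
      apply (H_not_origin z); [now apply ANd|destruct Hz; lra|]. now apply (loop_0 k). }
    destruct (L (H z) E) as [_ P]; [specialize (HT z Hz); lra|].
    rewrite (germ_GH _ _ _ _ _ germ) in P by now apply ANd.
    destruct Hz as [Zx [Zt Zy]].
    pose proof (lobe_quartic_neg k z 1 ltac:(auto) ltac:(lra) (AQ z ltac:(repeat split; tauto)) ltac:(lra)).
    unfold marker in P. lra. }
  assert (SegA : forall z, A z -> forall s, 0 <= s <= 1 -> A (lerp p1 z s)).
  { intros z [Zx [Zt Zy]] s Hs. unfold A, lerp. cbn [xc yc tc].
    unfold p1, xc, yc, tc in *; cbn [fst snd] in *. rewrite Zx, Zt. repeat split; try ring; nra. }
  assert (S1 : side k (H p1) < 0).
  { destruct (X2_cases k (H p1) hk0 X1' (H_not_origin p1 (ANd p1 A1) Ht)) as [Tp _].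
    rewrite side_pos by lra. unfold marker in M1. pose proof (pow_lt _ 4 Tp). lra. }
  assert (SNeg : forall z, A z -> side k (H z) < 0).
  { intros z Hz. assert (0 < side k (H p1) * side k (H z)); [|nra].
    apply (segment_same_sign A (fun z => side k (H z))); auto. apply rcont_H; [exact ANd|apply rcont_side]. }
  (* Inside the loop, [x = 0] forces [|y| <= w], so [H z] is within [2 w] of a neck point [q]. Then
     [G q] is on the loop of [X1] and within [2 M w] of [z]. Separation would require [t <= 16 M w],
     but [w <= 3 e M t] gives [16 M w <= 48/1000 t]. *)
  assert (XN : forall z, A z -> xc (H z) <> 0).
  { intros z Hz X0. destruct (side_neg k _ hk0 (SNeg z Hz)) as [Tz Qz].
    set (tz := tc (H z)) in *. set (w := neck k tz). pose proof (neck_pos k tz Tz) as Hw. fold w in Hw.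
    specialize (HT z Hz). fold tz in HT.
    assert (Hw' : w <= e * tz) by (apply neck_small; auto; lra).
    assert (Yz : Rabs (yc (H z)) <= w).
    { apply pow4_le_inv; [lra|]. unfold w. rewrite neck_pow by exact Tz.
      replace (Rabs (yc (H z)) ^ 4) with ((Rabs (yc (H z)) ^ 2) ^ 2) by ring. rewrite pow2_abs.
      unfold quartic in Qz. rewrite X0 in Qz. nra. }
    set (q := (0, 1 * w, tz) : pt).
    assert (Lq : loop k q) by (apply neck_loop; auto).
    destruct (L q Lq) as [Nq Mq]; [change (tc q) with tz; lra|].
    assert (LG : loop k (G q)).
    { destruct (X1_cases k (G q) hk0) as [_ [[? _]|[? _]]]; [| |assumption|lra].
      - apply (germ_X2 _ _ _ _ _ germ); [exact Nq|]. apply X2_pieces. now left.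
      - now apply G_not_origin. }
    assert (D1 : d1 q (H z) <= 2 * w).
    { unfold d1. rewrite X0. fold tz. unfold q, xc, yc, tc; cbn [fst snd]. fold (yc (H z)).
      rewrite !Rminus_diag, Rabs_R0. assert (Rabs (1 * w - yc (H z)) <= 2 * w); [|lra].
      revert Yz. unfold Rabs; repeat destruct Rcase_abs; lra. }
    assert (D2 : d1 (G q) z <= M * (2 * w)).
    { rewrite <- (germ_GH _ _ _ _ _ germ z) by now apply ANd.
      eapply Rle_trans; [apply (germ_G _ _ _ _ _ germ); [exact Nq|]|].
      - specialize (HN z Hz). lra.
      - apply Rmult_le_compat_l; lra. }
    pose proof (loop_separation k (G q) z 1 LG ltac:(auto) ltac:(destruct Hz; lra) (AQ z Hz)) as Sep.
    destruct Hz as [_ [Zt _]]. rewrite Zt in Sep.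
    assert (w * M <= e * (3 * (M * t)) * M) by (apply Rmult_le_compat_r; nra).
    replace (e * (3 * (M * t)) * M) with (3 * t * (e * M ^ 2)) in H0 by ring. rewrite EeM in H0. lra. }
  assert (XS : 0 < xc (H p1) * xc (H p2)).
  { apply (segment_same_sign A (fun z => xc (H z))); auto. apply rcont_H; [exact ANd|apply rcont_xc]. }
  destruct (X2_cases k (H p1) hk0 X1' (H_not_origin p1 (ANd p1 A1) Ht)) as [T1 [[_ ?]|[_ C1]]]; [lra|].
  destruct (X2_cases k (H p2) hk0 X2' (H_not_origin p2 (ANd p2 A2) Ht)) as [T2 [[_ ?]|[_ C2]]]; [lra|].
  (* As [x] keeps its sign along the image, both endpoints lie in one tube of [X2]; pulling that
     tube back by [G] would put [p1] and [p2] on the same side of [y = 0]. *)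
  assert (C : exists c, (c = 1 \/ c = -1) /\ tube c 0 (H p1) /\ tube c 0 (H p2)).
  { destruct C1 as [[C1 ?]|[C1 ?]]; destruct C2 as [[C2 ?]|[C2 ?]]; try nra; eauto. }
  destruct C as [c [Hc [D1 D2]]].
  assert (P : 0 < yc (G (H p1)) * yc (G (H p2))).
  { pose proof (HN p1 A1). pose proof (HN p2 A2). pose proof (HT p1 A1). pose proof (HT p2 A2).
    apply (X2_tube_same_side c); auto; try lra.
    rewrite (germ_GH _ _ _ _ _ germ) by now apply ANd. apply (marker_tube k 1 (1 / 2)); auto; lra. }
  rewrite !(germ_GH _ _ _ _ _ germ) in P by now apply ANd.
  unfold p1, p2, yc in P; cbn [fst snd] in P. nra.
Qed.

End Germ.

Theorem theorem2p1 (k : nat) (hk : (4 < k)%nat) :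
  bilip_outer_equiv (X1 k) (X2 k) /\
  ambient_topo_equiv (X1 k) (X2 k) /\
  ~ ambient_lip_equiv (X1 k) (X2 k).
Proof.
  split; [apply outer_equiv; lia|]. split; [apply topo_equiv; lia|].
  intros E. apply lip_germ_of_equiv in E as (H & G & d & M & germ).
  exact (lip_germ_absurd k hk H G d M germ).
Qed.
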